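(* For every integer $k \ge 3$ there is an integer $n_0=n_0(k)$ such that every digraph $D$ on $n\ge n_0$ vertices with $\delta^0(D)\ge \lceil (n+k)/2\rceil -1$ is $k$-ordered Hamiltonian.
   Context: Digraphs have no loops and at most one edge in each direction between any pair of vertices. For a digraph $D$, $\delta^0(D):=\min\{\delta^+(D),\delta^-(D)\}$ is the minimum semi-degree (the minimum of the minimum outdegree and minimum indegree). $D$ is $k$-ordered Hamiltonian if for every sequence $s_1,\dots,s_k$ of distinct vertices of $D$ there is a directed Hamilton cycle of $D$ which encounters $s_1,\dots,s_k$ in this (cyclic) order. *)

(* Defs.v *)
From mathcomp Require Import all_boot.
Set Implicit Arguments. Unset Strict Implicit. Unset Printing Implicit Defensive.

(* A digraph on the finite vertex type T is given by its edge relation e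
   (e x y means there is an arc x -> y). Loops are excluded by requiring
   irreflexivity; a relation automatically has at most one arc in each
   direction between two vertices. *)
Definition digraph (T : finType) (e : rel T) : Prop := irreflexive e.

Definition outdeg (T : finType) (e : rel T) (v : T) : nat := #|[set u | e v u]|.
Definition indeg (T : finType) (e : rel T) (v : T) : nat := #|[set u | e u v]|.

Definition min_semideg_ge (T : finType) (e : rel T) (d : nat) : Prop :=
  forall v : T, d <= outdeg e v /\ d <= indeg e v.

Definition ham_cycle (T : finType) (e : rel T) (c : seq T) : Prop :=
  [/\ uniq c, (forall v : T, v \in c) & cycle e c].

(* D is k-ordered Hamiltonian: for every sequence s_1..s_k of distinct vertices
   there is a Hamilton cycle encountering them in this cyclic order, i.e. some
   rotation of the cycle contains s as a subsequence. *)
Definition k_ordered_hamiltonian (T : finType) (e : rel T) (k : nat) : Prop :=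
  forall s : seq T, size s = k -> uniq s ->
    exists c : seq T, ham_cycle e c /\ exists i : nat, subseq s (rot i c).

Definition ceil_half (m : nat) : nat := (m + 1) %/ 2.

(* Main.v *)
(** Let n be the order of D and d the bound on the semidegrees, so that
2d >= n + k - 2.

Suppose first that any two vertex sets of size at least d either share linearly
many vertices or span quadratically many arcs.  Then any two vertices are joined
by a path with at most two inner vertices avoiding a given small set.  Choose
O(log n) disjoint pairs (x_j, y_j) such that for all u, v some pair satisfies
x_j -> u and v -> y_j, and take a longest cycle C meeting s_1, ..., s_k, x_1,
y_1, x_2, y_2, ... in this cyclic order.  If H = D - C is nonempty, a path u..v
of H cannot be inserted between consecutive vertices of C; counting gives
d^-_H(u) + d^+_H(v) >= |H| + k - 2 whenever u reaches v in H, so H is strongly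
connected and, by an argument of Ghouila-Houri type, Hamilton-connected.  For a
pair with x_j -> u and v -> y_j the stretch from x_j to y_j would have to be too
long to be replaced by a Hamilton path of H, and the count is contradicted.

Otherwise D contains two disjoint almost complete digraphs ("cores") covering
almost all vertices.  Every vertex can be entered from and left towards at least
one of the cores.  The exact degree condition provides enough vertices (some of
them helped by a private neighbour) at which a cycle can cross from one core to
the other, to serve all gaps (s_i, s_{i+1}) and to balance the vertices that are
forced to cross.  All exceptional vertices are then linked in a suitable order
through the cores, and the remaining core vertices are inserted one by one. *)

Require Import Defs.
From mathcomp Require Import all_boot zify.
Set Implicit Arguments. Unset Strict Implicit. Unset Printing Implicit Defensive.

(** * Lists and cycles with marked vertices *)

(** Inserting a path into a longest cycle must not remove marks, so the usual Ghouila-Houri saving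
    is available only on a mark-free stretch; the pairs (x_j, y_j) exist to provide such a stretch
    for any ends u, v. For fixed u, v more than n^2/8 pairs serve, so a greedy choice leaves at most
    7/8 of the unserved (u, v) each time.

    With two cores the budget is kept per direction: a vertex counts one unit if it can be left
    towards core ~~b and one if it can be entered from core b. The demand is 1 per free vertex and 2
    per mark, n + k in total. If ability alone (at least [tau] arcs to or from the core) falls
    short, then 2d + 2 >= n + k forces core vertices to have neighbours without the ability, and
    disjoint arcs to these supply the missing units. The core ends of these arcs become reserved, so
    they are chosen to hold at most one unit in each direction, except in a direction with ample
    surplus. *)

Section Lists.
Variables (T : eqType).
Implicit Types (X Y Z : pred T) (x a b : T) (l w : seq T).

(** On a closed walk this equals the number of X-elements plus the number of Y-elements; written
    over consecutive pairs, it can be bounded step by step. *)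
Fixpoint pairs X Y x l : nat :=
  if l is y :: l' then X x + Y y + pairs X Y y l' else 0.

Lemma pairsE X Y x l : pairs X Y x l = count X (belast x l) + count Y l.
Proof. by elim: l x => //= y l IH x; rewrite IH; lia. Qed.

Lemma perm_belast x l : last x l = x -> perm_eq (belast x l) l.
Proof.
move=> ll; rewrite -(perm_cons x).
have E : x :: l = rcons (belast x l) x by rewrite -{3}ll -lastI.
by rewrite E perm_sym perm_rcons.
Qed.

Lemma pairs_cat X Y x l1 l2 :
  pairs X Y x (l1 ++ l2) = pairs X Y x l1 + pairs X Y (last x l1) l2.
Proof. by elim: l1 x => //= y l IH x; rewrite IH addnA. Qed.

Lemma pairs_le X Y x l :
  (forall w1 a b w2, x :: l = w1 ++ a :: b :: w2 -> X a -> Y b -> False) ->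
  pairs X Y x l <= size l.
Proof.
elim: l x => //= y l IH x H.
have := IH y (fun w1 a b w2 E => H (x :: w1) a b w2 (congr1 (cons x) E)).
have: ~~ (X x && Y y) by apply/negP => /andP[/(H [::] _ _ l erefl)].
by case: (X x); case: (Y y) => //=; lia.
Qed.

Lemma split_first Y l : has Y l ->
  exists B b w, [/\ l = B ++ b :: w, Y b & ~~ has Y B].
Proof.
elim: l => //= y l IH.
case Yy: (Y y) => /=; first by move=> _; exists [::], y, l.
move=> /IH[B [b [w [-> Yb nB]]]]; exists (y :: B), b, w.
by split=> //=; rewrite Yy.
Qed.

Lemma split_last Y l : has Y l ->
  exists B b w, [/\ l = B ++ b :: w, Y b & ~~ has Y w].
Proof.
rewrite -has_rev => /split_first[B [b [w [E Yb nB]]]].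
exists (rev w), b, (rev B); split=> //; last by rewrite has_rev.
by rewrite -[l]revK E rev_cat rev_cons cat_rcons.
Qed.

(* If every passage from an X-element to a later Y-element jumps over at least
   p elements, then an X-Y pair of minimal distance encloses p - 1 steps that
   contribute nothing. *)
Lemma pairs_gap X Y p x l : 0 < p -> X x -> has Y l ->
  (forall w1 a B b w2, x :: l = w1 ++ a :: B ++ b :: w2 ->
     X a -> Y b -> p <= size B) ->
  pairs X Y x l + p.-1 <= size l.
Proof.
move=> p0; have [n] := ubnP (size l); elim: n x l => // n IH x l ln Xx hY H.
have [B [b [w [El Yb nB]]]] := split_first hY; subst l.
have pB : p <= size B by apply: (H [::] x B b w).
have Hw : pairs X Y b w <= size w.
  apply: pairs_le => w1 a b' w2 E Xa Yb'.
  suff: p <= 0 by lia.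
  apply: (H (x :: B ++ w1) a [::] b' w2) => //=.
  by rewrite E -catA.
(* If an X-element x' occurs before b, the argument restarts at x': the steps up to x' contribute at
   most one each. *)
have [hX|nX] := boolP (has X B).
  have [B1 [x' [B2 [EB Xx' nB1]]]] := split_first hX; subst B.
  rewrite -catA cat_cons in ln H *.
  rewrite -cat_rcons pairs_cat last_rcons.
  have H1 : pairs X Y x (rcons B1 x') <= size (rcons B1 x').
    apply: pairs_le => w1 a b' w2 E Xa Yb'.
    suff: p <= 0 by lia.
    apply: (H w1 a [::] b' (w2 ++ B2 ++ b :: w)) => //=.
    by rewrite -cat_rcons -cat_cons E -catA.
  have H2 : pairs X Y x' (B2 ++ b :: w) + p.-1 <= size (B2 ++ b :: w).
    apply: IH => //.
    - by move: ln; rewrite !size_cat /= ?size_cat /=; lia.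
    - by rewrite has_cat /= Yb orbT.
    move=> w1 a B b' w2 E; apply: (H (x :: B1 ++ w1)).
    by rewrite E /= -catA.
  by move: H1 H2; rewrite !size_cat ?size_rcons /= ?size_cat /=; lia.
(* On this stretch X holds only at x and Y only at b, so its |B| + 1 steps contribute 2 in all. *)
rewrite pairsE.
have E1 : belast x (B ++ b :: w) = (x :: B) ++ belast b w.
  by rewrite belast_cat /= -cat_rcons -lastI.
move: Hw; rewrite pairsE => Hw.
rewrite E1 !count_cat /= Xx Yb.
move: nX nB; rewrite !has_count -!eqn0Ngt size_cat /= => /eqP-> /eqP->; lia.
Qed.

End Lists.

Section Rotations.
Variable T : eqType.
Implicit Types s t : seq T.

(** The bounded search keeps [tour] Boolean, so that [tour_max] can maximise the length. *)
Definition rotated s t := has (fun i => s == rot i t) (iota 0 (size t).+1).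

Lemma rotatedP s t : reflect (exists i, s = rot i t) (rotated s t).
Proof.
apply: (iffP hasP) => [[i _ /eqP->]|[i ->]]; first by exists i.
have [le|lt] := leqP i (size t).
  by exists i; rewrite // mem_iota add0n ltnS.
by exists 0; rewrite ?mem_iota // rot0 rot_oversize // ltnW.
Qed.

Lemma rot_rotated i s t : rotated s t -> rotated (rot i s) t.
Proof.
move=> /rotatedP[j ->]; apply/rotatedP.
have small n u : exists2 m, m <= size u & rot n u = rot m u :> seq T.
  have [le|/ltnW lt] := leqP n (size u); first by exists n.
  by exists 0 => //; rewrite rot0 rot_oversize.
have [m m_le ->] := small i (rot j t).
have [p p_le ->] := small j t.
by rewrite size_rot in m_le; rewrite rot_add_mod //; eexists.
Qed.

Lemma rotated_refl s : rotated s s.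
Proof. by apply/rotatedP; exists 0; rewrite rot0. Qed.

Lemma mem_rotated s t : rotated s t -> s =i t.
Proof. by move=> /rotatedP[i ->] x; rewrite mem_rot. Qed.

(** The cyclic successor of x is the same in t and in its rotation. This identifies the first mark
    met after a base point that is itself a mark. *)
Lemma rotated_last s t w1 x y w2 : uniq t -> rotated (rcons s x) t ->
  t = w1 ++ x :: y :: w2 -> exists s', s = y :: s'.
Proof.
move=> Ut /rotatedP[j Ej] Et.
have N1 : next t x = y.
  rewrite -(next_rot (size w1) Ut) Et rot_size_cat /= eqxx //.
have N2 : next (rcons s x) x = y by rewrite Ej next_rot.
have U : uniq (rcons s x) by rewrite Ej rot_uniq.
move: N2; rewrite -(next_rot (size s) U) -cats1 rot_size_cat /=.
case: s Ej {U} => [|z s] Ej; last by rewrite /= eqxx => ->; exists s.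
by move/(congr1 size): Ej; rewrite size_rot Et size_cat /=; lia.
Qed.

End Rotations.

Section Tours.
Variables (T : finType) (e : rel T).
Implicit Types (G : {set T}) (ms l hp W B : seq T) (x y a b u : T).

(* The cycle is listed from the successor of the base point x round to x; the
   marks ms occur on it in their cyclic order. *)
Definition tour G ms x l : bool :=
  [&& path e x l, last x l == x, uniq l, all [in G] l
    & (0 < size l) && rotated [seq y <- l | y \in ms] ms].

Lemma tour_last_mem G ms x l : tour G ms x l -> x \in l.
Proof. by case/and5P=> _ /eqP{1}<- _ _ /andP[]; case: l => //= y l _ _; exact: mem_last. Qed.

Lemma tour_marks G ms x l : tour G ms x l -> {subset ms <= l}.
Proof.
case/and5P=> _ _ _ _ /andP[_ /mem_rotated E] y; rewrite -E mem_filter.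
by case/andP.
Qed.

(** B carries no mark, and the new path is disjoint from a tour that carries all marks, so the
    sequence of marks read off is unchanged. *)
Lemma tour_replace G ms x W B b w u hp :
  tour G ms x (W ++ B ++ b :: w) -> ~~ has [in ms] B ->
  e (last x W) u -> path e u hp -> e (last u hp) b -> uniq (u :: hp) ->
  all (fun y => (y \in G) && (y \notin W ++ B ++ b :: w)) (u :: hp) ->
  tour G ms x (W ++ (u :: hp) ++ b :: w).
Proof.
move=> Tl nB eWu pu eub U /allP AG.
have ml := tour_marks Tl.
case/and5P: Tl => pl /eqP ll Ul /allP Al /andP[_ Rl].
have sub : subseq (W ++ b :: w) (W ++ B ++ b :: w).
  by apply: cat_subseq; [exact: subseq_refl | exact: suffix_subseq].
have mem_sub y : y \in W ++ b :: w -> y \in W ++ B ++ b :: w by apply: mem_subseq.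
have PE : perm_eq (W ++ (u :: hp) ++ b :: w) ((u :: hp) ++ W ++ b :: w).
  by rewrite perm_catCA.
apply/and5P; split.
- move: pl; rewrite !cat_path /= eWu pu eub /= => /and3P[-> _].
  by case/andP.
- by rewrite -ll !last_cat.
- rewrite (perm_uniq PE) cat_uniq U (subseq_uniq sub Ul) andbT.
  apply/hasPn => y /mem_sub yl; apply/negP => /AG /andP[_].
  by rewrite yl.
- apply/allP => y; rewrite (perm_mem PE) mem_cat => /orP[/AG/andP[]//|/mem_sub].
  exact: Al.
apply/andP; split; first by rewrite !size_cat /= !addnS.
have F0 : [seq y <- u :: hp | y \in ms] = [::].
  apply/eqP; rewrite -(negbK (_ == _)) -has_filter; apply/hasPn => y /AG/andP[_ yl].
  by apply: contra yl => /ml.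
have FB : [seq y <- B | y \in ms] = [::].
  by apply/eqP; rewrite -(negbK (_ == _)) -has_filter.
by move: Rl; rewrite !filter_cat F0 FB.
Qed.

Lemma tour_rot G ms x l1 y l2 : tour G ms x (l1 ++ y :: l2) ->
  tour G ms y (l2 ++ rcons l1 y).
Proof.
have PE : perm_eq (l2 ++ rcons l1 y) (l1 ++ y :: l2).
  by rewrite perm_catC cat_rcons.
case/and5P=> pl /eqP ll Ul /allP Al /andP[_ Rl].
move: pl ll; rewrite cat_path last_cat /= => /and3P[p1 ey p2] ll.
apply/and5P; split.
- by rewrite cat_path p2 ll rcons_path p1 ey.
- by rewrite last_cat last_rcons.
- by rewrite (perm_uniq PE).
- by apply/allP => z; rewrite (perm_mem PE); exact: Al.
apply/andP; split; first by rewrite size_cat size_rcons addnS.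
move: Rl; rewrite -cat_rcons !filter_cat => /rot_rotated Rl.
have := Rl (size [seq z <- rcons l1 y | z \in ms]).
by rewrite rot_size_cat.
Qed.

Lemma tour_max G ms x l : tour G ms x l ->
  exists x' l', tour G ms x' l' /\
    forall x'' l'', tour G ms x'' l'' -> size l'' <= size l'.
Proof.
move=> Tl.
pose P n := [exists y, [exists t : n.-tuple T, tour G ms y t]].
have PP y t : tour G ms y t -> P (size t).
  by move=> Tt; apply/existsP; exists y; apply/existsP; exists (in_tuple t).
have exP : exists n, P n by exists (size l); exact: PP Tl.
have bP n : P n -> n <= #|T|.
  case/existsP=> y /existsP[t /and5P[_ _ Ut _ _]].
  by rewrite -(size_tuple t) -(card_uniqP Ut) max_card.
case: (ex_maxnP exP bP) => n /existsP[y /existsP[t Tt]] max.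
exists y, t; split => // z t' /PP/max; by rewrite size_tuple.
Qed.

End Tours.

(** * Counting neighbours on a longest tour *)

Section Longest.
Variables (T : finType) (e : rel T).
Implicit Types (G : {set T}) (ms l hp W B : seq T) (x y a b u : T).

Definition dout G v := #|[set w in G | e v w]|.
Definition din G v := #|[set w in G | e w v]|.

Definition longest G ms l :=
  forall x' l', tour e G ms x' l' -> size l' <= size l.

Definition rest G l := G :\: [set y in l].

Lemma tour_belast G ms x l : tour e G ms x l -> perm_eq (belast x l) l.
Proof. by case/and5P=> _ /eqP ll _ _ _; apply: perm_belast. Qed.

Lemma card_rest G ms x l : tour e G ms x l -> #|G| = size l + #|rest G l|.
Proof.
case/and5P=> _ _ /card_uniqP <- /allP Al _.
rewrite -(cardsID [set y in l] G) /rest; congr (_ + _).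
apply: eq_card => y; rewrite !inE andbC.
by case yl: (y \in l) => //=; rewrite Al.
Qed.

Lemma count_rest G ms x l (Z : pred T) : tour e G ms x l ->
  #|[set w in G | Z w]| = count Z l + #|[set w in rest G l | Z w]|.
Proof.
case/and5P=> _ _ Ul /allP Al _.
rewrite -size_filter -(card_uniqP (filter_uniq Z Ul)).
rewrite -(cardsID [set y in l] [set w in G | Z w]); congr (_ + _).
  apply: eq_card => y; rewrite !inE mem_filter andbC.
  by case yl: (y \in l) => //=; rewrite ?andbF ?andbT // Al.
by apply: eq_card => y; rewrite !inE andbA.
Qed.

Lemma pairs_tour G ms x l (X Y : pred T) : tour e G ms x l ->
  pairs X Y x l = count X l + count Y l.
Proof. by move=> /tour_belast/permP/(_ X) <-; rewrite pairsE. Qed.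

Section Max.
Variables (G : {set T}) (ms : seq T) (x : T) (l : seq T).
Hypotheses (Tl : tour e G ms x l) (max : longest G ms l).
Variables (u : T) (hp : seq T).
Hypotheses (pu : path e u hp) (Uu : uniq (u :: hp)).
Hypothesis (Hu : all [in rest G l] (u :: hp)).

Let X : pred T := e^~ u.
Let Y : pred T := e (last u hp).

(** Otherwise [tour_replace] would exchange B for the longer path [u :: hp]. *)
Lemma longest_gap w1 a B b w2 : x :: l = w1 ++ a :: B ++ b :: w2 ->
  ~~ has [in ms] B -> X a -> Y b -> (size hp).+1 <= size B.
Proof.
move=> E nB Xa Yb.
have [W EW] : exists W, x :: W = rcons w1 a.
  case: w1 E => [|z w1] /= [-> _]; first by exists [::].
  by exists (rcons w1 a).
have El : l = W ++ B ++ b :: w2.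
  by move: E; rewrite -cat_rcons -EW => -[].
have Ea : last x W = a by rewrite -[RHS](last_rcons x w1) -EW.
move: (Tl); rewrite El => /tour_replace/(_ nB).
rewrite Ea => /(_ _ _ Xa pu Yb Uu) Tn.
have /Tn/max : all (fun y => (y \in G) && (y \notin W ++ B ++ b :: w2)) (u :: hp).
  by rewrite -El; apply/allP=> y /(allP Hu); rewrite !inE andbC.
by rewrite El !size_cat /=; lia.
Qed.

Lemma longest_basic : count X l + count Y l <= size l.
Proof.
rewrite -(pairs_tour _ _ Tl); apply: pairs_le => w1 a b w2 E Xa Yb.
by have := @longest_gap w1 a [::] b w2 E isT Xa Yb.
Qed.

(** Up to y the tour is free of marks, so [longest_gap] applies there to every stretch and
    [pairs_gap] saves [size hp]; beyond y only empty stretches are used. *)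
Lemma longest_improved B y R : l = B ++ y :: R -> ~~ has [in ms] B ->
  X x -> Y y -> count X l + count Y l + size hp <= size l.
Proof.
move=> El nB Xx Yy.
rewrite -(pairs_tour _ _ Tl) El -cat_rcons pairs_cat last_rcons size_cat.
have H1 : pairs X Y y R <= size R.
  apply: pairs_le => w1 a b w2 E Xa Yb.
  have := @longest_gap (x :: B ++ w1) a [::] b w2 _ isT Xa Yb.
  by rewrite El E /= -catA => /(_ erefl).
have H2 : pairs X Y x (rcons B y) + (size hp).+1.-1 <= size (rcons B y).
  apply: pairs_gap => //; first by rewrite has_rcons Yy.
  move=> w1 a B' b w2 E; apply: (@longest_gap w1 a B' b (w2 ++ R)).
    by rewrite El -cat_rcons -cat_cons E -!(catA, cat_cons).
  (* B' starts after x and stops before the final y, hence it lies within B. *)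
  apply: contra nB => /hasP[z zB' zm]; apply/hasP; exists z => //.
  move: E; rewrite (lastI b w2) -rcons_cons -rcons_cat -rcons_cons -rcons_cat.
  move/rcons_inj => [E _].
  case: w1 E => [|c w1] [_ ->]; first by rewrite mem_cat zB'.
  by rewrite !(mem_cat, inE) zB' !orbT.
by move: H2 => /=; lia.
Qed.

End Max.

Lemma longest_path (H : {set T}) z : z \in H -> exists u hp,
  [/\ path e u hp, uniq (u :: hp), all [in H] (u :: hp) &
   (forall a, a \in H -> e a u -> a \in u :: hp) /\
   (forall b, b \in H -> e (last u hp) b -> b \in u :: hp)].
Proof.
move=> zH.
pose Q u (hp : seq T) := [&& path e u hp, uniq (u :: hp) & all [in H] (u :: hp)].
pose P n := [exists u, [exists t : n.-tuple T, Q u t]].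
have PP u t : Q u t -> P (size t).
  by move=> Tt; apply/existsP; exists u; apply/existsP; exists (in_tuple t).
have exP : exists n, P n by exists 0; apply: (PP z [::]); rewrite /Q /= zH.
have bP n : P n -> n <= #|T|.
  case/existsP=> u /existsP[t /and3P[_ Ut _]].
  by have := max_card [in u :: t]; rewrite (card_uniqP Ut) /= size_tuple => /ltnW.
case: (ex_maxnP exP bP) => n /existsP[u /existsP[t Qt]] max.
case/and3P: (Qt) => pt Ut At.
exists u, t; split=> //; split=> a aH ea; apply/negPn/negP => nat.
  have Qa : Q a (u :: t).
    apply/and3P; split; first by rewrite /= ea pt.
      by rewrite cons_uniq nat Ut.
    by apply/allP => w; rewrite inE => /orP[/eqP->|/(allP At)].
  by have := max _ (PP _ _ Qa); rewrite /= size_tuple ltnn.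
have Qa : Q u (rcons t a).
  rewrite /Q rcons_path pt ea -rcons_cons rcons_uniq nat Ut all_rcons aH.
  exact: At.
by have := max _ (PP _ _ Qa); rewrite size_rcons size_tuple ltnn.
Qed.

Lemma card_in_path (H : {set T}) (Z : pred T) u hp a :
  (forall w, w \in H -> Z w -> w \in u :: hp) -> a \in u :: hp -> ~~ Z a ->
  #|[set w in H | Z w]| <= size hp.
Proof.
move=> sub ain nZa.
have c : #|[set w in u :: hp]| <= size (u :: hp) by rewrite cardsE card_size.
have /subset_leq_card : [set w in H | Z w] \subset [set w in u :: hp] :\ a.
  apply/subsetP => w; rewrite !inE => /andP[wH Zw].
  by rewrite -in_cons sub // andbT; apply: contraNneq nZa => <-.
by move: c; rewrite (cardsD1 a) inE ain /=; lia.
Qed.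

End Longest.

(** * Ghouila-Houri type theorems *)

Section GhouilaHouri.
Variable T : finType.
Implicit Types (e : rel T) (G : {set T}) (l hp : seq T) (x y a b u v : T).

Lemma din_lt e G y : irreflexive e -> y \in G -> din e G y < #|G|.
Proof.
move=> irr yG; rewrite (cardsD1 y G) yG ltnS; apply/subset_leq_card/subsetP => w.
by rewrite !inE => /andP[-> ewy]; rewrite andbT; apply: contraTneq ewy => ->; rewrite irr.
Qed.

Lemma dout_lt e G y : irreflexive e -> y \in G -> dout e G y < #|G|.
Proof.
move=> irr yG; rewrite (cardsD1 y G) yG ltnS; apply/subset_leq_card/subsetP => w.
by rewrite !inE => /andP[-> ewy]; rewrite andbT; apply: contraTneq ewy => ->; rewrite irr.
Qed.

Lemma rotated_nil l : rotated [seq y <- l | y \in [::]] [::].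
Proof. by rewrite (eq_filter (a2 := pred0)) ?filter_pred0 // rotated_refl. Qed.

(** Close a longest path from its last vertex b to the first out-neighbour of b on it: the cycle
    contains b and all its out-neighbours. The second cycle arises symmetrically at the first
    vertex. *)
Lemma long_tour e G z : irreflexive e -> z \in G ->
  (forall x y, x \in G -> y \in G -> #|G| <= dout e G x + din e G y) ->
  (exists x l b, [/\ tour e G [::] x l, b \in G & dout e G b < size l]) /\
  (exists x l b, [/\ tour e G [::] x l, b \in G & din e G b < size l]).
Proof.
move=> irr zG deg; have [u [hp [pu Uu Au [Hi Ho]]]] := longest_path e zG.
have AG w : w \in u :: hp -> w \in G by move/(allP Au).
set b := last u hp; have bG : b \in G by apply/AG/mem_last.
have uG : u \in G by apply/AG/mem_head.
split.
  have /card_gt0P[w] : 0 < dout e G b by have := deg b b bG bG; have := din_lt irr bG; lia.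
  rewrite inE => /andP[wG ebw].
  have /split_first[B [c [l2 [E ebc nB]]]] : has (e b) (u :: hp).
    by apply/hasP; exists w => //; exact: Ho.
  have Eb : last c l2 = b.
    by case: B E {nB} => [|d B] /= [? E]; [rewrite /b E; subst u | rewrite /b E last_cat].
  exists b, (c :: l2), b; split=> //.
    apply/and5P; split=> //.
    - move: pu; case: B E {nB} => [|d B] /= [? ->]; first by subst u; rewrite ebc => ->.
      by rewrite cat_path /= ebc => /and3P[].
    - by rewrite /= Eb.
    - by move: Uu; rewrite E cat_uniq => /and3P[].
    - by apply/allP => d dl; apply: AG; rewrite E mem_cat dl orbT.
    by rewrite rotated_nil.
  rewrite /= ltnS; apply: (card_in_path (Z := e b) (u := c) (a := b)); rewrite ?irr //.
    move=> d dG ebd; move: (Ho d dG ebd); rewrite E mem_cat => /orP[] // dB.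
    by case/hasP: nB; exists d.
  by move: (mem_last c l2); rewrite Eb.
have /card_gt0P[w] : 0 < din e G u by have := deg u u uG uG; have := dout_lt irr uG; lia.
rewrite inE => /andP[wG ewu].
have /split_last[B [c [l2 [E ecu nl2]]]] : has (e^~ u) (u :: hp).
  by apply/hasP; exists w => //; exact: Hi.
case: B E => [|d B] /= [Eu E]; first by subst c; rewrite irr in ecu.
subst d; exists c, (u :: rcons B c), u; split=> //.
  apply/and5P; split=> //.
  - by move: pu; rewrite E -cat_rcons cat_path /= ecu => /andP[].
  - by rewrite /= last_rcons.
  - by move: Uu; rewrite E -cat_rcons -cat_cons cat_uniq => /and3P[].
  - by apply/allP => d dl; apply: AG; rewrite E -cat_rcons -cat_cons mem_cat dl.
  by rewrite rotated_nil.
rewrite /= ltnS; apply: (card_in_path (Z := e^~ u) (u := u) (a := u)); rewrite ?irr ?mem_head //.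
move=> d dG edu; move: (Hi d dG edu); rewrite E -cat_rcons -cat_cons mem_cat => /orP[] // dB.
by case/hasP: nl2; exists d.
Qed.

Theorem ghouila_houri e G : irreflexive e -> 0 < #|G| ->
  (forall x y, x \in G -> y \in G -> #|G| <= dout e G x + din e G y) ->
  exists x l, tour e G [::] x l /\ size l = #|G|.
Proof.
move=> irr /card_gt0P[z zG] deg.
have [[x0 [l0 [c [T0 cG Hc]]]] [x1 [l1 [d [T1 dG Hd]]]]] := long_tour irr zG deg.
have [x [l [Tl max]]] := tour_max T0.
exists x, l; split=> //.
have Er := card_rest Tl.
have [E0|/card_gt0P[h hH]] := posnP #|rest G l|; first by rewrite Er E0 addn0.
have [u [hp [pu Uu Au [Hi Ho]]]] := longest_path e hH.
have H1 : #|[set w in rest G l | e w u]| <= size hp.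
  by apply: (card_in_path (Z := e^~ u) (u := u) (a := u)); rewrite /= ?irr ?mem_head.
have H2 : #|[set w in rest G l | e (last u hp) w]| <= size hp.
  by apply: (card_in_path (u := u) (a := last u hp)); rewrite ?irr ?mem_last.
have hp_r : (size hp).+1 <= #|rest G l|.
  rewrite -[_.+1]/(size (u :: hp)) -(card_uniqP Uu); apply/subset_leq_card/subsetP.
  by move=> w /(allP Au).
have sub w : w \in u :: hp -> w \in G by move/(allP Au); rewrite inE => /andP[].
have uG : u \in G by apply/sub/mem_head.
have vG : last u hp \in G by apply/sub/mem_last.
have C1 : din e G u = _ := count_rest (e^~ u) Tl.
have C2 : dout e G (last u hp) = _ := count_rest (e (last u hp)) Tl.
have L0 := max _ _ T0; have L1 := max _ _ T1.
(* Without an in-neighbour of u on l, [deg] for c and u would give |G| < |l| + |H|, where H is the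
   uncovered set; this is why [long_tour] is needed. *)
have hasX : has (e^~ u) l.
  rewrite has_count; move: (deg c u cG uG) Hc L0 H1 C1 hp_r Er; clear => *; lia.
have hasY : has (e (last u hp)) l.
  rewrite has_count; move: (deg _ d vG dG) Hd L1 H2 C2 hp_r Er; clear => *; lia.
case/hasP: hasX => a al ea.
have [l2 [l3 El]] : exists l2 l3, l = l2 ++ a :: l3.
  by case/splitPr: al => l2 l3; exists l2, l3.
have Tr : tour e G [::] a (l3 ++ rcons l2 a) by apply: (tour_rot (x := x)); rewrite -El.
have PE : perm_eq (l3 ++ rcons l2 a) l by rewrite El perm_catC cat_rcons.
have maxr : longest e G [::] (l3 ++ rcons l2 a).
  by move=> x' l' /max; rewrite (perm_size PE).
have Eres : rest G (l3 ++ rcons l2 a) = rest G l.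
  by apply/setP => w; rewrite !inE (perm_mem PE).
have /split_first[B [b [w [Ew eb nB]]]] : has (e (last u hp)) (l3 ++ rcons l2 a).
  by rewrite (perm_has _ PE).
have nm : ~~ has [in [::]] B by apply/hasPn => y.
have Hr : all [in rest G (l3 ++ rcons l2 a)] (u :: hp) by rewrite Eres.
have : count (e^~ u) l + count (e (last u hp)) l + size hp <= size l.
  have := longest_improved Tr maxr pu Uu Hr Ew nm ea eb.
  by rewrite (perm_size PE) !(permP PE).
(* Inside the uncovered set H each end of the path has at most [size hp] relevant neighbours, and on
   l there are together at most |l| - [size hp]; the sum stays below |l| + |H|. *)
by move: (deg _ _ vG uG) H1 H2 hp_r; rewrite C1 C2 Er; clear; lia.
Qed.

End GhouilaHouri.

Lemma leq_card_inj_in (T : finType) (A B : {set T}) (f : T -> T) :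
  {in A &, injective f} -> (forall x, x \in A -> f x \in B) -> #|A| <= #|B|.
Proof.
move=> fI fAB; rewrite -(card_in_imset fI); apply/subset_leq_card/subsetP => y.
by case/imsetP => x xA ->; exact: fAB.
Qed.

(* Merging v into u turns Hamilton paths from u to v into Hamilton cycles. *)
Theorem ham_connected (T : finType) (e : rel T) (G : {set T}) (u v : T) :
  irreflexive e -> u \in G -> v \in G -> u != v ->
  (forall x y, x \in G -> y \in G -> #|G| < dout e G x + din e G y) ->
  exists hp, [/\ path e u hp, uniq (u :: hp), all [in G] (u :: hp),
    last u hp = v & (size hp).+1 = #|G|].
Proof.
move=> irr uG vG uv deg.
(* The merged vertex is called u; it keeps the out-arcs of u and receives the in-arcs of v. Every
   degree drops by at most one. *)
pose s y := if y == u then v else y.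
pose e' := [rel x y | (x != y) && e x (s y)].
have irr' : irreflexive e' by move=> x; rewrite /= eqxx.
pose G' := G :\ v.
have uG' : u \in G' by rewrite !inE uv.
have cG : #|G| = #|G'|.+1 by rewrite (cardsD1 v) vG.
have d1 (A : {set T}) a : #|A| <= #|A :\ a|.+1 by have := cardsD1 a A; case: (a \in A) => ->; lia.
have Dout x : x \in G' -> dout e G x <= (dout e' G' x).+1.
  rewrite !inE => /andP[xv xG].
  have [->|xu] := eqVneq x u.
    apply: leq_trans (d1 _ v) _; rewrite ltnS; apply/subset_leq_card/subsetP => w.
    rewrite !inE => /and3P[wv wG euw]; rewrite wv wG /=.
    have wu : w != u by apply: contraTneq euw => ->; rewrite irr.
    by rewrite eq_sym wu /s (negPf wu).
  apply: leq_trans (d1 _ u) _; rewrite ltnS.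
  apply: (@leq_card_inj_in _ _ _ (fun w => if w == v then u else w)) => [a b|w].
    rewrite !inE => /and3P[/negPf au _ _] /and3P[/negPf bu _ _].
    have [->|av] := eqVneq a v; have [->|bv] := eqVneq b v => // E.
      by rewrite -E eqxx in bu.
    by rewrite E eqxx in au.
  rewrite !inE => /and3P[wu wG exw].
  have [wv|wv] := eqVneq w v; first by rewrite uv uG /= xu /s eqxx -wv.
  rewrite wv wG /= /s (negPf wu) exw andbT.
  by apply: contraTneq exw => ->; rewrite irr.
have Din y : y \in G' -> din e G (s y) <= (din e' G' y).+1.
  rewrite !inE => /andP[yv yG]; rewrite /s.
  have [->|yu] := eqVneq y u.
    apply: leq_trans (d1 _ u) _; rewrite ltnS; apply/subset_leq_card/subsetP => w.
    rewrite !inE => /and3P[wu wG ewv]; rewrite wG /= wu /s eqxx ewv !andbT.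
    by apply: contraTneq ewv => ->; rewrite irr.
  apply: leq_trans (d1 _ v) _; rewrite ltnS; apply/subset_leq_card/subsetP => w.
  rewrite !inE => /and3P[wv wG ewy]; rewrite wv wG /= /s (negPf yu) ewy andbT.
  by apply: contraTneq ewy => ->; rewrite irr.
have sG y : y \in G' -> s y \in G.
  by rewrite !inE /s => /andP[_ yG]; case: ifP.
have [|x y xG' yG'|x [l [Tl sl]]] := @ghouila_houri _ e' G' irr'.
- by rewrite (cardsD1 u) uG'.
- have xG : x \in G by move: xG'; rewrite inE => /andP[].
  by move: (deg x (s y) xG (sG y yG')) (Dout x xG') (Din y yG'); rewrite cG; clear; lia.
have ul : u \in l.
  case/and5P: Tl => _ _ Ul Al _.
  suff -> : (u \in l) = (u \in G') by [].
  apply: (@subset_cardP _ (mem l) (mem G')); first by rewrite (card_uniqP Ul).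
  by apply/subsetP => w /(allP Al).
have [l2 [l3 El]] : exists l2 l3, l = l2 ++ u :: l3.
  by case/splitPr: ul => l2 l3; exists l2, l3.
have : tour e' G' [::] u (l3 ++ rcons l2 u) by apply: (tour_rot (x := x)); rewrite -El.
rewrite -rcons_cat; set l0 := l3 ++ l2 => T0.
have sl0 : (size l0).+1 = #|G'|.
  by rewrite -sl El !size_cat /= addnS addnC.
case/and5P: T0; rewrite rcons_path rcons_uniq all_rcons => /andP[p0 e0] _ /andP[ul0 U0] /andP[_ A0] _.
have vl0 : v \notin l0 by apply/negP => /(allP A0); rewrite !inE eqxx.
(* As l0 avoids u, [s] is the identity on it, so arcs of e' into l0 are arcs of e. *)
have p0' : path e u l0.
  elim: l0 {sl0 e0 U0 A0 vl0} ul0 (u) p0 => //= y l0 IH.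
  rewrite inE negb_or => /andP[uy ul0] a /andP[/andP[_]].
  by rewrite /s eq_sym (negPf uy) => -> /= /(IH ul0).
exists (rcons l0 v); split.
- by move: e0; rewrite rcons_path p0' /= /s eqxx => /andP[].
- by rewrite cons_uniq rcons_uniq mem_rcons inE negb_or uv ul0 vl0.
- rewrite /= uG all_rcons vG /=; apply/allP => w /(allP A0).
  by rewrite inE => /andP[].
- by rewrite last_rcons.
by rewrite size_rcons sl0 -cG.
Qed.

(** * Strong connectivity of the uncovered part *)

Section Reach.
Variables (T : finType) (e : rel T) (H : {set T}) (k : nat).
Hypothesis irr : irreflexive e.

Definition within := [rel a b | e a b && (b \in H)].

Lemma within_path u v : u \in H -> connect within u v -> exists hp,
  [/\ path e u hp, uniq (u :: hp), all [in H] (u :: hp) & last u hp = v].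
Proof.
move=> uH /connectP[p pp ->]; case/shortenP: pp => q pq Uq _.
exists q; split=> //.
  by apply: sub_path pq => a b /andP[].
rewrite /= uH; elim: q (u) {Uq} pq => //= b q IH a /andP[/andP[_ ->]] /IH.
exact.
Qed.

Lemma within_in u v : u \in H -> connect within u v -> v \in H.
Proof.
by move=> uH /(within_path uH)[hp [_ _ Au <-]]; apply: (allP Au); apply: mem_last.
Qed.

Let R v := [set w | connect within v w].
Let R' u := [set w in H | connect within w u].

Lemma dout_reach v : dout e H v < #|R v|.
Proof.
rewrite (cardsD1 v) inE connect0 ltnS; apply/subset_leq_card/subsetP => w.
rewrite !inE => /andP[wH evw]; rewrite connect1 ?andbT /= ?evw //.
by apply: contraTneq evw => ->; rewrite irr.
Qed.

Lemma din_reach u : u \in H -> din e H u < #|R' u|.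
Proof.
move=> uH; rewrite (cardsD1 u) !inE uH connect0 ltnS.
apply/subset_leq_card/subsetP => w; rewrite !inE => /andP[wH ewu].
rewrite wH connect1 ?andbT /= ?ewu //.
by apply: contraTneq ewu => ->; rewrite irr.
Qed.

Hypothesis (k1 : 0 < k).
Hypothesis deg : forall u v, u \in H -> connect within u v ->
  #|H| + k <= din e H u + dout e H v + 2.

Let meet (A B : {set T}) : A \subset H -> B \subset H -> #|H| < #|A| + #|B| ->
  exists2 w, w \in A & w \in B.
Proof.
move=> AH BH lt; have /card_gt0P[w] : 0 < #|A :&: B|.
  have : #|A :|: B| <= #|H| by apply/subset_leq_card; rewrite subUset AH.
  by move: (cardsUI A B) lt; clear; lia.
by rewrite inE => /andP[wA wB]; exists w.
Qed.

Let RH v : v \in H -> R v \subset H.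
Proof. by move=> vH; apply/subsetP => w; rewrite inE; apply: within_in. Qed.

Let R'H u : R' u \subset H.
Proof. by apply/subsetP => w; rewrite inE => /andP[]. Qed.

(** The set reached from v and the set reaching u exceed the respective degrees, so by [deg] their
    sizes sum to more than |H| and they share a vertex. *)
Lemma within_sym u v : u \in H -> connect within u v -> connect within v u.
Proof.
move=> uH uv; have vH := within_in uH uv.
have [|w] := meet (RH vH) (R'H u).
  by move: (deg uH uv) (dout_reach v) (din_reach uH) k1; clear; lia.
rewrite !inE => vw /andP[_ wu]; exact: connect_trans vw wu.
Qed.

(** As reachability is symmetric, [R z] contains [R' z] and so has more than half of H; any two such
    sets meet. *)
Lemma within_strong u v : u \in H -> v \in H -> connect within u v.
Proof.
have half z : z \in H -> #|H| < #|R z|.*2.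
  move=> zH; have E : R' z \subset R z.
    by apply/subsetP => w; rewrite !inE => /andP[]; apply: within_sym.
  move: (deg zH (connect0 _ _)) (dout_reach z) (din_reach zH) k1 (subset_leq_card E).
  by clear; lia.
move=> uH vH; have [|w] := meet (RH uH) (RH vH).
  by move: (half u uH) (half v vH); clear; lia.
by rewrite !inE => uw /(within_sym vH); apply: connect_trans.
Qed.

End Reach.

(** * A longest marked cycle is Hamiltonian *)

Section MarkedTour.
Variables (T : finType) (e : rel T) (d k : nat).
Hypotheses (irr : irreflexive e) (k3 : 3 <= k) (dk : #|T| + k <= d.*2.+2).
Hypothesis (degO : forall v, d <= dout e setT v).
Hypothesis (degI : forall v, d <= din e setT v).

(** If H is left over, a Hamilton path of H from h to v competes with the stretch between
    consecutive marks a, b where a -> h and v -> b. Saving its length |H| - 1 in [longest_improved]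
    gives 2d <= |l| - (|H| - 1) + 2(|H| - 1) = n - 1, too small for k >= 3. *)
Theorem tour_extends ms x l : uniq ms -> tour e setT ms x l ->
  (forall u v, u != v -> exists w1 a b w2,
     [/\ ms = w1 ++ a :: b :: w2, e a u & e v b]) ->
  exists x' l', tour e setT ms x' l' /\ size l' = #|T|.
Proof.
move=> Ums T0 cover; have [{}x [{T0}l [Tl max]]] := tour_max T0.
exists x, l; split=> //.
have Er := card_rest Tl; rewrite cardsT in Er.
have [E0|/card_gt0P[h]] := posnP #|rest setT l|; first by rewrite Er E0 addn0.
have C1 u : din e setT u = count (e^~ u) l + din e (rest setT l) u.
  exact: count_rest (e^~ u) Tl.
have C2 u : dout e setT u = count (e u) l + dout e (rest setT l) u.
  exact: count_rest (e u) Tl.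
have basic u hp := longest_basic Tl max (u := u) (hp := hp).
move EH: (rest setT l) => H in Er C1 C2 basic *; move=> hH.
have deg u v : u \in H -> connect (within e H) u v ->
    #|H| + k <= din e H u + dout e H v + 2.
  move=> uH /(within_path uH)[hp [pu Uu Au Ev]].
  have := basic u hp pu Uu Au; rewrite Ev.
  by move: (degO v) (degI u) dk Er; rewrite C1 C2; clear; lia.
have strong := within_strong irr (leq_trans (isT : 0 < 3) k3) deg.
have deg' u v : u \in H -> v \in H -> #|H| < dout e H u + din e H v.
  by move=> uH vH; move: (deg v u vH (strong v u vH uH)) k3; clear; lia.
(* Both degrees of h inside H are at most |H| - 1, so [deg] yields |H| >= k. *)
have H3 : 2 < #|H|.
  move: (deg h h hH (connect0 _ _)) (dout_lt irr hH) (din_lt irr hH) k3; clear; lia.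
have /card_gt0P[v] : 0 < #|H :\ h|.
  by move: H3; rewrite (cardsD1 h) hH; clear; lia.
rewrite !inE => /andP[vh vH].
have [w1 [a [b [w2 [Ems eah evb]]]]] := cover h v ltac:(by rewrite eq_sym).
have [hp [pu Uu Au Ev sz]] := ham_connected irr hH vH ltac:(by rewrite eq_sym) deg'.
have al : a \in l by apply: (tour_marks Tl); rewrite Ems mem_cat mem_head orbT.
have [l2 [l3 El]] : exists l2 l3, l = l2 ++ a :: l3.
  by case/splitPr: al => l2 l3; exists l2, l3.
have Tr : tour e setT ms a (l3 ++ rcons l2 a) by apply: (tour_rot (x := x)); rewrite -El.
have PE : perm_eq (l3 ++ rcons l2 a) l by rewrite El perm_catC cat_rcons.
have maxr : longest e setT ms (l3 ++ rcons l2 a).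
  by move=> x' l' /max; rewrite (perm_size PE).
have Eres : rest setT (l3 ++ rcons l2 a) = H.
  by rewrite -EH; apply/setP => w; rewrite !inE (perm_mem PE).
(* The tour is now based at a, so the first mark met is b, the successor of a in [ms]. *)
have [s' Es] : exists s', [seq y <- l3 ++ l2 | y \in ms] = b :: s'.
  apply: (rotated_last Ums _ Ems).
  case/and5P: Tr => _ _ _ _ /andP[_].
  by rewrite -rcons_cat filter_rcons Ems mem_cat mem_head orbT.
have /split_first[B [c [w [Ew cm nB]]]] : has [in ms] (l3 ++ l2).
  by rewrite has_filter Es.
have Ec : c = b.
  move: Es; rewrite Ew filter_cat /= cm; move: nB; rewrite has_filter negbK => /eqP->.
  by case.
have Hr : all [in rest setT (l3 ++ rcons l2 a)] (h :: hp) by rewrite Eres.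
have El' : l3 ++ rcons l2 a = B ++ b :: rcons w a.
  by rewrite -rcons_cat Ew Ec -rcons_cons -rcons_cat.
have : count (e^~ h) l + count (e v) l + size hp <= size l.
  have := longest_improved Tr maxr pu Uu Hr El' nB eah.
  by rewrite Ev (perm_size PE) !(permP PE); apply.
move: (degO v) (degI h) dk (dout_lt irr vH) (din_lt irr hH) k3 sz.
by rewrite C1 C2 Er; clear; lia.
Qed.

End MarkedTour.

Lemma card_setD_ge (T : finType) (A B : {set T}) : #|A| <= #|A :\: B| + #|B|.
Proof. by rewrite -(cardsID B A) addnC leq_add2l subset_leq_card // subsetIr. Qed.

(** * The dense case *)

Section Linking.
Variables (T : finType) (e : rel T) (d q : nat).
Hypotheses (irr : irreflexive e).
Hypothesis (degO : forall v, d <= dout e setT v).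
Hypothesis (degI : forall v, d <= din e setT v).

Definition edges (A B : {set T}) := [set p : T * T | [&& p.1 \in A, p.2 \in B & e p.1 p.2]].

Hypothesis dense : forall A B : {set T}, d <= #|A| -> d <= #|B| ->
  #|T| <= #|A :&: B| * q \/ #|T| ^ 2 <= #|edges A B| * q.

(** F meets at most |F| common neighbours and at most 2 |F| n arcs, less than what [dense] provides;
    an inner vertex or an inner arc off F survives. *)
Lemma link a b (F : {set T}) : 4 * q * #|F|.+1 <= #|T| -> exists p,
  [/\ path e a (rcons p b), uniq p, size p <= 2 & {in p, forall y, y \notin F}].
Proof.
move=> hF.
have T0 : 0 < #|T| by apply/card_gt0P; exists a.
pose A := [set w in setT | e a w]; pose B := [set w in setT | e w b].
case: (dense (degO a) (degI b)); rewrite -/A -/B => h.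
  have /card_gt0P[z] : 0 < #|(A :&: B) :\: F|.
    have := card_setD_ge (A :&: B) F; move: h hF T0.
    move: #|A :&: B| #|_ :\: _| #|F| #|T| => E D f n; clear=> h hF n0 le.
    have : 4 * f.+1 <= E; last by move: le; lia.
    have : q * (4 * f.+1) <= q * E by lia.
    by rewrite leq_mul2l => /orP[/eqP q0|//]; move: h; rewrite q0 muln0; lia.
  rewrite !inE /= => /and3P[zF az zb]; exists [:: z].
  by split=> //=; [rewrite az zb | move=> y; rewrite inE => /eqP->].
pose FF := setX F setT :|: setX setT F.
have cFF : #|FF| <= 2 * (#|F| * #|T|).
  have := cardsUI (setX F [set: T]) (setX [set: T] F).
  by rewrite !cardsX cardsT -/FF; clear; lia.
have /card_gt0P[[x y]] : 0 < #|edges A B :\: FF|.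
  have := card_setD_ge (edges A B) FF.
  move: h hF cFF T0; move: #|edges A B| #|FF| #|_ :\: _| #|F| #|T| => E c D f n.
  clear=> h hF cFF n0 le.
  have q0 : 0 < q by case: q h {hF} => // ; rewrite muln0; nia.
  have h1 : n * (4 * q * f.+1) <= E * q by apply: leq_trans h; rewrite -mulnn leq_mul2l hF orbT.
  have : q * (4 * (f.+1 * n)) <= q * E by lia.
  rewrite leq_mul2l -[q == 0]negbK -lt0n q0 /=; lia.
rewrite !inE /= => /andP[]; rewrite !andbT negb_or => /andP[xF yF] /and3P[ax yb xy].
exists [:: x; y]; split=> //=.
- by rewrite ax xy yb.
- by rewrite inE andbT; apply: contraTneq xy => ->; rewrite irr.
by move=> z; rewrite !inE => /orP[]/eqP->.
Qed.

(** The filter equation records both the order of the targets and that all linking vertices lie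
    outside F. In the induction used linking vertices join F. The last target may be a itself, which
    closes the walk. *)
Lemma link_path (s : seq T) a (F : {set T}) :
  a \in F -> uniq s -> {subset s <= F} -> 4 * q * (#|F| + 2 * size s).+1 <= #|T| ->
  exists l, [/\ path e a l, last a l = last a s, uniq l & [seq y <- l | y \in F] = s].
Proof.
elim: s a F => [|b s IH] a F aF /=; first by exists [::].
move=> /andP[bs Us] sF hF.
have [|p [pp Up p2 pF]] := @link a b F; first by apply: leq_trans hF; rewrite leq_mul2l; apply/orP; right; clear; lia.
have bF : b \in F by apply: sF; apply: mem_head.
pose F' := F :|: [set y in p].
have cF' : #|F'| <= #|F| + 2.
  have := cardsUI F [set y in p]; rewrite -/F' => cc.
  have : #|[set y in p]| <= size p by rewrite cardsE card_size.
  by move: cc p2; clear; lia.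
have [||||l [pl ll Ul fl]] := IH b F' => //.
- by rewrite inE bF.
- by move=> y ys; rewrite inE sF // inE ys orbT.
- by apply: leq_trans hF; rewrite leq_mul2l; apply/orP; right; move: cF'; clear; lia.
have mem_l y : y \in l -> y \in F' -> y \in s.
  by move=> yl yF; rewrite -fl mem_filter yF yl.
exists (p ++ b :: l); split.
- by move: pp; rewrite rcons_path cat_path /= => /andP[-> ->].
- by rewrite last_cat.
- rewrite cat_uniq Up /= Ul andbT.
  have bl : b \notin l by apply: contra bs => bl; apply: mem_l; rewrite // inE bF.
  rewrite bl andbT negb_or; apply/andP; split.
    by apply/negP => /pF; rewrite bF.
  apply/hasPn => y yl; apply/negP => yp.
  have ys : y \in s by apply: mem_l; rewrite // !inE yp orbT.
  by move: (pF y yp); rewrite sF // inE ys orbT.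
rewrite filter_cat /= bF.
rewrite (_ : [seq y <- p | y \in F] = [::]); last first.
  by apply/eqP; rewrite -(negbK (_ == _)) -has_filter; apply/hasPn => y /pF.
have /all_filterP sfix : all [in F] s.
  by apply/allP => y ys; apply: sF; rewrite inE ys orbT.
congr (_ :: _); rewrite -[RHS]sfix -[in RHS]fl -filter_predI.
by apply: eq_filter => y /=; rewrite !inE; case: (y \in F).
Qed.

Lemma link_tour (ms : seq T) : ms != [::] -> uniq ms -> 4 * q * (3 * size ms).+1 <= #|T| ->
  exists x l, tour e setT ms x l.
Proof.
case: ms => // a s _ Us hs; pose F := [set y in a :: s].
have cF : #|F| = (size s).+1 by rewrite cardsE (card_uniqP Us).
have Us' : uniq (rcons s a) by rewrite rcons_uniq.
have [||||l [pl ll Ul fl]] := @link_path (rcons s a) a F.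
- by rewrite inE mem_head.
- by [].
- by move=> y; rewrite mem_rcons !inE.
- by apply: leq_trans hs; rewrite leq_mul2l cF size_rcons; apply/orP; right; clear => /=; lia.
exists a, l; rewrite last_rcons in ll; apply/and5P; split => //.
- by rewrite ll eqxx.
- by apply/allP => y; rewrite inE.
rewrite (eq_filter (a2 := [in F])) => [|y]; last by rewrite !inE.
rewrite fl; apply/andP; split.
  by case: l fl {pl ll Ul} => //; case: (s).
by apply/rotatedP; exists 1; rewrite rot1_cons.
Qed.

End Linking.

(** With j about 2 log n, 2^j beats the n^2 pairs (u, v) while the cost of O(j) marks stays below
    n. *)
Lemma log_bound C : exists n0, forall n, n0 <= n -> exists j,
  n ^ 2 < 2 ^ j /\ C * j.+1 <= n.
Proof.
exists (2 ^ (16 * C).+1) => n hn.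
pose t := trunc_log 2 n.
have n0 : 0 < n by apply: leq_trans hn; rewrite expn_gt0.
have /andP[lo hi] := trunc_log_bounds (isT : 1 < 2) n0.
exists (t.+1 + t.+1); split.
  by rewrite expnD -mulnn ltn_mul.
apply: leq_trans lo.
have ht : (16 * C).+1 <= t.
  have : 2 ^ (16 * C).+1 < 2 ^ t.+1 by apply: leq_ltn_trans hi.
  by rewrite ltn_exp2l.
have E := odd_double_half t.
have h1 : (t./2).+1 * (t./2).+1 <= 2 ^ t.
  rewrite -{3}E expnD -addnn expnD.
  have := ltn_expl t./2 (isT : 1 < 2); have : 0 < 2 ^ odd t by rewrite expn_gt0.
  by clear; nia.
apply: leq_trans h1; move: E ht; clear; case: (odd t) => /=; nia.
Qed.

Lemma filter_cat_inv (T : Type) (p : pred T) (l a b : seq T) : filter p l = a ++ b ->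
  exists l1 l2, [/\ l = l1 ++ l2, filter p l1 = a & filter p l2 = b].
Proof.
elim: l a => [|x l IH] a /=; first by case: a; case: b => //; exists [::], [::].
case: ifP => px.
  case: a => [|y a] /= => [E|[<- /IH[l1 [l2 [-> <- <-]]]]].
    by exists [::], (x :: l); split=> //=; rewrite px.
  by exists (x :: l1), l2; rewrite /= px.
by move=> /IH[l1 [l2 [-> <- <-]]]; exists (x :: l1), l2; rewrite /= px.
Qed.

(** A cut of the filtered list lifts to a cut of the whole list, and rotating there undoes the
    rotation of t. *)
Lemma rotated_subseq (T : eqType) (p : pred T) (l t : seq T) :
  rotated (filter p l) t -> exists i, subseq t (rot i l).
Proof.
move=> /rotatedP[i]; rewrite {1}/rot => /filter_cat_inv[l1 [l2 [-> E1 E2]]].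
exists (size l1); rewrite rot_size_cat -[X in subseq X _](cat_take_drop i t) -E1 -E2.
by rewrite -filter_cat filter_subseq.
Qed.

(** * Logarithmically many pairs of marks serving all (u, v) *)

Section Cover.
Variables (T : finType) (e : rel T) (d : nat).
Hypothesis (dn : #|T| <= d.*2).
Hypothesis (degO : forall v, d <= dout e setT v).
Hypothesis (degI : forall v, d <= din e setT v).

Definition hit (ab uv : T * T) := e ab.1 uv.1 && e uv.2 ab.2.

Definition fresh (F : {set T}) :=
  [set ab : T * T | [&& ab.1 \notin F, ab.2 \notin F & ab.1 != ab.2]].

(** Both neighbourhoods keep more than 9n/20 vertices outside F, and 81/400 exceeds 1/8 by enough to
    absorb the diagonal. *)
Lemma card_fresh_hit (F : {set T}) (uv : T * T) : 20 * #|F|.+1 <= #|T| ->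
  #|T| ^ 2 < 8 * #|[set ab in fresh F | hit ab uv]|.
Proof.
move=> hF.
pose A := [set w in setT | e w uv.1] :\: F; pose B := [set w in setT | e uv.2 w] :\: F.
have cA : d <= #|A| + #|F| by apply: leq_trans (degI _) (card_setD_ge _ _).
have cB : d <= #|B| + #|F| by apply: leq_trans (degO _) (card_setD_ge _ _).
have sub : setX A B :\: [set (a, a) | a in A] \subset [set ab in fresh F | hit ab uv].
  apply/subsetP => -[a b]; rewrite !inE /hit /= => /andP[ndiag /andP[]].
  move=> /andP[aF ea] /andP[bF eb]; rewrite aF bF ea eb !andbT /=.
  apply: contraNneq ndiag => E; rewrite -E; apply/imsetP; exists a => //.
  by rewrite !inE aF ea.
have := card_setD_ge (setX A B) [set (a, a) | a in A].
rewrite cardsX; have := leq_imset_card (fun a => (a, a)) (mem A).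
move: (subset_leq_card sub) cA cB dn hF.
move: #|A| #|B| #|F| #|T| #|_ :\: _| #|[set _ | _ in _]| #|[set _ | _]|.
clear=> a b f n x i c xc; nia.
Qed.

(* Double counting: on average a fresh pair is hit by at least an eighth of W. *)
Lemma cover_step (F : {set T}) (W : {set T * T}) : 20 * #|F|.+1 <= #|T| ->
  0 < #|W| -> exists2 ab, ab \in fresh F & #|W| <= 8 * #|[set uv in W | hit ab uv]|.
Proof.
move=> hF W0.
have [ab /andP[]|none] := pickP [pred ab | (ab \in fresh F) && (#|W| <= 8 * #|[set uv in W | hit ab uv]|)].
  by exists ab.
have low : #|W| * #|T| ^ 2 < 8 * \sum_(ab in fresh F) #|[set uv in W | hit ab uv]|.
  rewrite (eq_bigr (fun ab => \sum_(uv in W) hit ab uv)); last first.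
    move=> ab _; rewrite -sum1_card big_mkcond [RHS]big_mkcond.
    by apply: eq_bigr => uv _; rewrite !inE; case: (uv \in W); case: (hit ab uv).
  rewrite exchange_big big_distrr -sum_nat_const /=.
  have S uv : 8 * (\sum_(ab in fresh F) hit ab uv) = 8 * #|[set ab in fresh F | hit ab uv]|.
    congr (_ * _); rewrite -sum1_card big_mkcond [RHS]big_mkcond.
    by apply: eq_bigr => ab _; rewrite [in RHS]inE; case: (ab \in fresh F); case: (hit ab uv).
  have [uv uvW] := card_gt0P W0.
  rewrite (bigD1 uv) //= [X in _ < X](bigD1 uv) //= -addSn leq_add //.
    by rewrite S card_fresh_hit.
  by apply: leq_sum => p _; rewrite S ltnW // card_fresh_hit.
have high : 8 * \sum_(ab in fresh F) #|[set uv in W | hit ab uv]| <= #|T| ^ 2 * #|W|.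
  rewrite big_distrr /=; apply: (@leq_trans (\sum_(ab in fresh F) #|W|)).
    by apply: leq_sum => ab abF; have := none ab; rewrite /= abF /= => /negbT; lia.
  rewrite sum_nat_const leq_mul2r; apply/orP; right.
  by rewrite -mulnn -card_prod max_card.
by have := leq_trans low high; rewrite mulnC ltnn.
Qed.

Definition ends (ps : seq (T * T)) := flatten [seq [:: p.1; p.2] | p <- ps].

(** Each new pair is chosen by [cover_step] for the elements of W not yet hit, of which at most 7/8
    remain. F grows by two each time, which keeps the ends distinct. *)
Lemma cover_iter L (F : {set T}) (W : {set T * T}) : 20 * (#|F| + 2 * L).+1 <= #|T| ->
  exists ps, [/\ size ps <= L, uniq (ends ps), {in ends ps, forall y, y \notin F}
    & 8 ^ L * #|[set uv in W | ~~ has (hit^~ uv) ps]| <= 7 ^ L * #|W|].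
Proof.
elim: L F W => [|L IH] F W hF.
  exists [::]; split=> //; rewrite !mul1n subset_leq_card //.
  by apply/subsetP => p; rewrite !inE => /andP[].
have [W0|W0] := posnP #|W|.
  exists [::]; split=> //; rewrite W0 muln0 leqn0 muln_eq0; apply/orP; right.
  by rewrite -leqn0 -W0 subset_leq_card //; apply/subsetP => p; rewrite !inE => /andP[].
have [|[a b] abF hW] := @cover_step F W _ W0.
  by apply: leq_trans hF; clear; lia.
move: abF; rewrite inE /= => /and3P[aF bF ab].
pose F' := F :|: [set a; b]; pose W' := [set uv in W | ~~ hit (a, b) uv].
have [|ps [sp Up pF' cp]] := IH F' W'.
  apply: leq_trans hF; have := cardsUI F [set a; b]; rewrite -/F' cards2 ab.
  by clear; lia.
have pF y : y \in ends ps -> [&& y \notin F, y != a & y != b].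
  by move/pF'; rewrite !inE !negb_or.
exists ((a, b) :: ps); split=> //.
- rewrite /ends /= -/(ends ps) Up andbT inE negb_or ab /=; apply/andP; split.
    by apply/negP => /pF; rewrite eqxx andbF.
  by apply/negP => /pF; rewrite eqxx !andbF.
- by move=> y; rewrite /ends /= -/(ends ps) !inE => /or3P[/eqP->|/eqP->|/pF/and3P[]].
have -> : [set uv in W | ~~ has (hit^~ uv) ((a, b) :: ps)] =
          [set uv in W' | ~~ has (hit^~ uv) ps].
  by apply/setP => uv; rewrite !inE /= negb_or andbA.
have : 8 * #|W'| <= 7 * #|W|.
  have E : [set uv in W | hit (a, b) uv] = W :\: W'.
    by apply/setP => uv; rewrite !inE; case: (uv \in W); case: (hit _ _).
  have : #|W :&: W'| + #|W :\: W'| = #|W| by rewrite cardsID.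
  have -> : W :&: W' = W' by apply/setP => uv; rewrite !inE; case: (uv \in W).
  by move: hW; rewrite E; clear; lia.
move: cp; rewrite !expnS; move: #|W'| #|W| #|_| (8 ^ L) (7 ^ L) => w' w c x y; clear; nia.
Qed.

Lemma mem_ends ps (a b : T) : (a, b) \in ps -> exists w1 w2, ends ps = w1 ++ a :: b :: w2.
Proof.
elim: ps => //= p ps IH; rewrite inE => /orP[/eqP<-|/IH[w1 [w2 E]]].
  by exists [::], (ends ps).
by exists (p.1 :: p.2 :: w1), w2; rewrite /ends /= -/(ends ps) E.
Qed.

Lemma cover_marks j (F : {set T}) : #|T| ^ 2 < 2 ^ j ->
  20 * (#|F| + 12 * j).+1 <= #|T| -> exists ps,
  [/\ size (ends ps) <= 12 * j, uniq (ends ps), {in ends ps, forall y, y \notin F}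
    & forall u v, exists w1 a b w2, [/\ ends ps = w1 ++ a :: b :: w2, e a u & e v b]].
Proof.
move=> nj hF; have [|ps [sp Up pF cp]] := @cover_iter (6 * j) F setT.
  by apply: leq_trans hF; clear; lia.
exists ps; split=> //.
  have -> : size (ends ps) = 2 * size ps by elim: (ps) => //= p s; rewrite /ends /=; lia.
  by move: sp; clear; lia.
move=> u v; have [[[a b] abs /andP[ea eb]]|nh] := altP (@hasP _ (hit^~ (u, v)) ps).
  by have [w1 [w2 E]] := mem_ends abs; exists w1, a, b, w2.
have : 0 < #|[set uv in [set: T * T] | ~~ has (hit^~ uv) ps]|.
  by apply/card_gt0P; exists (u, v); rewrite !inE nh.
move: cp; rewrite cardsT card_prod mulnn !expnM.
(* As 2 * 7^6 <= 8^6, six pairs halve the number of unserved (u, v); hence the choice of [6 * j]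
   pairs. *)
have : 2 ^ j * (7 ^ 6) ^ j <= (8 ^ 6) ^ j.
  by case: (posnP j) => [->//|j0]; rewrite -expnMn leq_exp2r //; clear; lia.
have : 0 < (7 ^ 6) ^ j by rewrite expn_gt0.
move: nj; move: ((8 ^ 6) ^ j) ((7 ^ 6) ^ j) (2 ^ j) (#|T| ^ 2) #|_|.
clear=> x y z n c nz y0 zx xc c0; nia.
Qed.

End Cover.

(** * Conclusion of the dense case *)

Theorem dense_ordered_hamiltonian k q : 3 <= k -> exists n0, forall (T : finType) (e : rel T) d,
  irreflexive e -> n0 <= #|T| -> #|T| + k <= d.*2.+2 ->
  (forall v, d <= dout e setT v) -> (forall v, d <= din e setT v) ->
  (forall A B : {set T}, d <= #|A| -> d <= #|B| ->
     #|T| <= #|A :&: B| * q \/ #|T| ^ 2 <= #|edges e A B| * q) ->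
  k_ordered_hamiltonian e k.
Proof.
(* There are at most k + 12 j marks: the term 144 q = 4 q * 3 * 12 pays for linking them, 300 >= 20
   * 12 for choosing the pairs. *)
move=> k3; have [n0 Hn0] := log_bound ((144 * q + 300) * k.+1).
exists n0 => T e d irr nT dk degO degI dense s sk Us.
have [j [nj hj]] := Hn0 _ nT.
have [||ps [sp Up pF cover]] := @cover_marks T e d _ degO degI j [set y in s] nj.
- by move: dk k3; clear; lia.
- rewrite cardsE (card_uniqP Us) sk; apply: leq_trans hj; clear; nia.
pose ms := s ++ ends ps.
have Ums : uniq ms.
  by rewrite cat_uniq Us Up andbT; apply/hasPn => y /pF; rewrite inE.
have [|||x0 [l0 T0]] := @link_tour T e d q irr degO degI dense ms => //.
- by rewrite /ms; case: (s) sk k3 => //= <-.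
- apply: leq_trans hj; rewrite /ms size_cat sk; move: sp; move: (size _) => z; clear; nia.
have [|x [l [Tl sl]]] := tour_extends irr k3 dk degO degI Ums T0.
  move=> u v _; have [w1 [a [b [w2 [E ea eb]]]]] := cover u v.
  by exists (s ++ w1), a, b, w2; rewrite /ms E catA.
have ll := tour_last_mem Tl.
case/and5P: Tl => pl /eqP lx Ul _ /andP[_ /rotatedP[i Ei]].
exists l; split.
  split=> // [v|].
    have : [set y in l] = setT.
      by apply/eqP; rewrite eqEcard subsetT cardsT -sl cardsE (card_uniqP Ul) leqnn.
    by move/setP/(_ v); rewrite !inE.
  by case: l pl lx {Ul sl Ei ll} => //= y l /andP[exy pl] lx; rewrite rcons_path pl lx.
have [j' Sj] : exists j', subseq ms (rot j' l).
  by apply: (rotated_subseq (p := [in ms])); rewrite Ei; apply/rotatedP; exists i.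
by exists j'; apply: subseq_trans Sj; rewrite prefix_subseq.
Qed.

Lemma markov_card (T : finType) (A : {set T}) (f : T -> nat) c :
  #|[set a in A | c < f a]| * c <= \sum_(a in A) f a.
Proof.
rewrite -sum_nat_const [X in _ <= X](bigID (fun a => c < f a)) /=.
apply: leq_trans (leq_addr _ _); rewrite (eq_bigl (fun a => (a \in A) && (c < f a))).
  by apply: leq_sum => a /andP[_ /ltnW].
by move=> a; rewrite inE.
Qed.

Lemma sum_card_swap (T : finType) (A B : {set T}) (r : rel T) :
  \sum_(a in A) #|[set b in B | r a b]| = \sum_(b in B) #|[set a in A | r a b]|.
Proof.
have E (C : {set T}) (Z : pred T) : #|[set b in C | Z b]| = \sum_(b in C) Z b.
  rewrite -sum1_card big_mkcond [RHS]big_mkcond.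
  by apply: eq_bigr => b _; rewrite inE; case: (b \in C); case: (Z b).
rewrite (eq_bigr (fun a => \sum_(b in B) r a b)) => [|a _]; last exact: E.
by rewrite exchange_big; apply: eq_bigr => b _; rewrite E.
Qed.

Lemma card_edges (T : finType) (e : rel T) (A B : {set T}) :
  #|edges e A B| = \sum_(a in A) #|[set b in B | e a b]|.
Proof.
rewrite -sum1_card (eq_bigl (fun p : T * T => (p.1 \in A) && ((p.2 \in B) && e p.1 p.2))).
  rewrite -(pair_big_dep [in A] (fun a b => (b \in B) && e a b) (fun _ _ => 1)) /=.
  by apply: eq_bigr => a _; rewrite -sum1_card; apply: eq_bigl => b; rewrite inE.
by move=> p; rewrite inE.
Qed.

(** * The near-clique case *)

(* Almost no arcs go from A to B, so the out-neighbourhood of a typical vertex of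
   A is almost the complement of B, which is almost A. *)
Lemma near_clique (T : finType) (e : rel T) d h (A B : {set T}) :
  0 < h -> 0 < #|T| -> #|T| <= d.*2 -> (forall v, d <= dout e setT v) ->
  d <= #|B| ->
  #|A :&: B| * (5 * h * h) ^ 2 <= #|T| ->
  #|edges e A B| * (5 * h * h) ^ 2 <= #|T| ^ 2 ->
  exists P : {set T}, [/\ P \subset A :\: B, h * #|A :\: P| <= #|T| &
    {in P, forall a, h * #|[set w in A | ~~ e a w]| <= #|T| /\
                     h * #|[set w in A | ~~ e w a]| <= #|T|}].
Proof.
set h1 := 5 * h * h; set n := #|T| => h0 T0 dn degO dB hAB heAB.
have h10 : 0 < h1 by rewrite /h1; move: h0; clear; nia.
(* The square in the hypothesis on arcs is spent twice: on the threshold n / h1 and on the bound n /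
   h1 for the number of vertices above it. *)
pose bad1 := [set a in A | n < h1 * #|[set b in B | e a b]|].
pose bad2 := [set a in A | n < h * #|[set w in A | ~~ e w a]|].
have b1 : h1 * #|bad1| <= n.
  have := markov_card A (fun a => h1 * #|[set b in B | e a b]|) n.
  rewrite -big_distrr -card_edges /= -/bad1.
  move: heAB h10 T0; move: #|bad1| #|edges e A B| => x y; clear.
  move=> h2 h3 h4 h5.
  have : n * (h1 * x) <= n * n.
    have : h1 * (x * n) <= h1 * (h1 * y) by rewrite leq_mul2l h5 orbT.
    by move: h2; rewrite -!mulnn; clear; lia.
  by rewrite leq_pmul2l.
have hI : h1 * #|A :&: B| <= n by move: hAB h10; clear; nia.
(* All but n / h1 out-neighbours of a lie in the complement of B, which has at most n - d <= d
   vertices; so a misses at most n / h1 of that complement, and A meets B in at most n / h1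
   vertices. *)
have nonO a : a \in A -> a \notin bad1 -> h1 * #|[set w in A | ~~ e a w]| <= 2 * n.
  move=> aA; rewrite inE aA /= -leqNgt => hb.
  have s1 : #|[set w in A | ~~ e a w]| <= #|A :&: B| + #|~: B :\: [set w in setT | e a w]|.
    apply: leq_trans (leq_card_setU _ _).1; apply/subset_leq_card/subsetP => w.
    by rewrite !inE => /andP[-> /= ->]; rewrite orbN.
  have s2 : #|[set w in setT | e a w]| <= #|[set b in B | e a b]| + #|~: B :&: [set w in setT | e a w]|.
    apply: leq_trans (leq_card_setU _ _).1; apply/subset_leq_card/subsetP => w.
    by rewrite !inE /= => ->; rewrite !andbT orbN.
  have := cardsID [set w in setT | e a w] (~: B); have := cardsC B.
  move: (degO a); rewrite /dout; move: s1 s2 hI hb dB dn; rewrite -/n.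
  move: #|[set w in A | _]| #|_ :\: _| #|_ :&: _| #|~: B| #|A :&: B| #|[set w in setT | _]|.
  move: #|B| #|[set b in B | _]|; clear; nia.
have b2 : h1 * #|bad2| <= 3 * h * n.
  have := markov_card A (fun a => h * #|[set w in A | ~~ e w a]|) n.
  rewrite -big_distrr -(sum_card_swap A A (fun w a => ~~ e w a)) /= -/bad2.
  (* Missing arcs inside A, counted by tails: a vertex of [bad1] accounts for at most n of them, any
     other for at most 2n / h1. *)
  have S : h1 * (\sum_(a in A) #|[set b in A | ~~ e a b]|) <= h1 * #|bad1| * n + n * (2 * n).
    rewrite big_distrr (bigID [in bad1]) /= leq_add //.
      apply: (@leq_trans (\sum_(a in bad1) h1 * n)).
        rewrite (eq_bigl [in bad1]) => [|a]; last by rewrite !inE; case: (a \in A).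
        by apply: leq_sum => a _; rewrite leq_mul2l max_card orbT.
      by rewrite sum_nat_const mulnCA mulnA.
    apply: (@leq_trans (\sum_(a in A) 2 * n)).
      rewrite big_mkcondr /=; apply: leq_sum => a aA; case: ifP => // nb.
      by apply: nonO; rewrite // nb.
    by rewrite sum_nat_const leq_mul2r max_card orbT.
  move: S b1 T0 h10; move: (\sum_(a in A) _) #|bad1| #|bad2| => s x y; clear.
  move=> S b1 n0 h10 M.
  have : n * (h1 * y) <= n * (3 * h * n).
    have : h1 * s <= 3 * n * n by nia.
    nia.
  by rewrite leq_pmul2l.
pose P := A :\: bad1 :\: bad2 :\: B.
have PA a : a \in P -> [/\ a \in A, a \notin bad1, a \notin bad2 & a \notin B].
  by rewrite /P !in_setD => /and4P[].
exists P; split.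
- by apply/subsetP => a /PA[aA _ _ aB]; rewrite inE aA aB.
- have s : #|A :\: P| <= #|bad1| + #|bad2| + #|A :&: B|.
    apply: leq_trans (leq_add (leq_card_setU _ _).1 (leqnn _)).
    apply: leq_trans (leq_card_setU _ _).1; apply/subset_leq_card/subsetP => a.
    rewrite /P !(in_setD, in_setU, in_setI); case: (a \in A) => /=; rewrite ?andbF //.
    by case: (a \in bad1); case: (a \in bad2); case: (a \in B).
  (* The three removed sets have at most n/h1, 3hn/h1 and n/h1 vertices, together at most n/h
     because h1 = 5 h h. *)
  have : h1 * (h * #|A :\: P|) <= h1 * n.
    move: s b1 b2 hI h0 T0; rewrite /h1.
    move: #|A :\: P| #|bad1| #|bad2| #|A :&: B|; clear=> p x y z s b1 b2 hI h0 n0.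
    have : 5 * h * h * p <= 5 * h * n; last by nia.
    have : 5 * h * h * p <= 5 * h * h * (x + y + z) by rewrite leq_mul2l s orbT.
    nia.
  by rewrite leq_pmul2l.
move=> a /PA[aA nb1 nb2 _]; split.
  have := nonO a aA nb1; rewrite /h1; move: h0 T0; move: #|[set _ in A | _]|; clear.
  move=> z h0 n0; nia.
by move: nb2; rewrite inE aA /= -leqNgt.
Qed.

Lemma subset_of_card (T : finType) (A B : {set T}) p : A \subset B ->
  #|A| <= p <= #|B| -> exists X : {set T}, [/\ A \subset X, X \subset B & #|X| = p].
Proof.
move=> AB /andP[Ap pB].
pose Y := [set x in take (p - #|A|) (enum (B :\: A))].
have YB : Y \subset B :\: A by apply/subsetP => x; rewrite inE => /mem_take; rewrite mem_enum.
exists (A :|: Y); split; first exact: subsetUl.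
  by rewrite subUset AB (subset_trans YB) // subsetDl.
have cY : #|Y| = p - #|A|.
  rewrite cardsE (card_uniqP _) ?take_uniq ?enum_uniq //.
  rewrite size_takel // -cardE cardsD (setIidPr AB); lia.
have := cardsUI A Y; rewrite cY (_ : A :&: Y = set0) ?cards0; first by move: Ap; clear; lia.
apply/setP => x; rewrite !in_set0 inE; apply/negP => /andP[xA /(subsetP YB)].
by rewrite inE xA.
Qed.

(** X uses up the elements outside M before touching the common ones, so as much of M as possible is
    left for Y. *)
Lemma pick_disjoint (T : finType) (A M a m : {set T}) p q :
  a \subset A -> m \subset M -> [disjoint a & M] -> [disjoint m & A] ->
  #|a| <= p <= #|A| -> #|m| <= q <= #|M| -> p + q <= #|A :|: M| ->
  exists X Y : {set T}, [/\ a \subset X, X \subset A, m \subset Y & Y \subset M] /\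
    [/\ [disjoint X & Y], #|X| = p & #|Y| = q].
Proof.
move=> aA mM aM mA /andP[ap pA] /andP[mq qM] pq.
have [le|lt] := leqP p #|A :\: M|.
  have [||X [aX XA cX]] := @subset_of_card _ a (A :\: M) p.
  - by rewrite subsetD aA aM.
  - by rewrite ap.
  have [||Y [mY YM cY]] := @subset_of_card _ m M q => //; first by rewrite mq.
  exists X, Y; move: XA; rewrite subsetD => /andP[XA XM]; split=> //; split=> //.
  exact: disjointWr XM.
have [||X [AX XA cX]] := @subset_of_card _ (A :\: M) A p; rewrite ?subsetDl ?(ltnW lt) //.
have aX : a \subset X by apply: subset_trans AX; rewrite subsetD aA aM.
have mX : [disjoint m & X] by apply: disjointWr mA.
have cM : #|M :\: X| + p = #|A :|: M|.
  rewrite -cX -(cardsID X (A :|: M)) addnC; congr (_ + _); apply: eq_card => x; rewrite !inE.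
    by case xX: (x \in X); rewrite ?andbF // (subsetP XA _ xX).
  case xX: (x \in X) => //=; case xA: (x \in A) => //=.
  by apply: contraFT xX => xM; apply: (subsetP AX); rewrite !inE xA xM.
have [||Y [mY YM cY]] := @subset_of_card _ m (M :\: X) q.
- by rewrite subsetD mM mX.
- by rewrite mq; move: cM pq; clear; lia.
move: YM; rewrite subsetD => /andP[YM YX].
by exists X, Y; split=> //; split=> //; rewrite disjoint_sym.
Qed.

(* A triple (b, v, b') records that the cycle enters v from core b and leaves it
   towards core b'. *)
Section Typed.
Variable T : eqType.
Implicit Types (tl : seq (bool * T * bool)) (b : bool).

Fixpoint tchain b tl b' :=
  if tl is t :: tl' then (t.1.1 == b) && tchain t.2 tl' b' else b == b'.

Definition verts tl : seq T := [seq t.1.2 | t <- tl].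
Definition sides b tl := has (fun t => t.2 == b) tl.

Lemma tchain_cat b c d l1 l2 : tchain b l1 c -> tchain c l2 d -> tchain b (l1 ++ l2) d.
Proof. by elim: l1 b => [b /eqP-> //|t l IH b /= /andP[-> /IH h] /h]. Qed.

Lemma tchain_insert b c d tl lp : tchain b tl c -> tchain d lp d -> sides d tl ->
  exists tl', [/\ tchain b tl' c, perm_eq tl' (tl ++ lp) & subseq tl tl'].
Proof.
move=> ht hlp /hasP[t tin /eqP td]; case/splitPr: tin ht => l1 l2.
exists (l1 ++ t :: lp ++ l2); split.
- elim: l1 b ht => [|t' l1 IH] b /= /andP[->]; last exact: IH.
  by rewrite td => h; apply: tchain_cat h.
- by rewrite -catA perm_cat2l /= perm_cons perm_catC.
- by rewrite cat_subseq //= eqxx suffix_subseq.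
Qed.

Lemma perm_sides b tl tl' : perm_eq tl tl' -> sides b tl = sides b tl'.
Proof. exact: perm_has. Qed.

Definition loops b (ps qs : seq T) : seq (bool * T * bool) :=
  flatten [seq [:: (b, p.1, ~~ b); (~~ b, p.2, b)] | p <- zip ps qs].

Lemma loops_chain b ps qs : tchain b (loops b ps qs) b.
Proof.
rewrite /loops; elim: (zip ps qs) => //= p l IH.
by rewrite !eqxx.
Qed.

Lemma verts_loops b ps qs : size ps = size qs -> perm_eq (verts (loops b ps qs)) (ps ++ qs).
Proof.
elim: ps qs => [|p ps IH] [|q qs] //= [/IH h].
change (perm_eq (p :: q :: verts (loops b ps qs)) (p :: ps ++ q :: qs)).
by apply/permP => a; have /permP/(_ a) := h; rewrite /= !count_cat /=; lia.
Qed.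

Variables (I O : bool -> pred T).
Definition valid (t : bool * T * bool) := I t.1.1 t.1.2 && O t.2 t.1.2.

Lemma skeleton (c : T -> bool * bool) b0 b (s ps qs : seq T) :
  (forall w1 x w2, s = w1 ++ x :: w2 ->
     O (c x).1 x && I (last b [seq (c y).2 | y <- w1]) x) ->
  {in ps, forall v, I b0 v && O (~~ b0) v} -> {in qs, forall v, I (~~ b0) v && O b0 v} ->
  size ps = count (fun x => c x == (b0, ~~ b0)) s ->
  size qs = count (fun x => c x == (~~ b0, b0)) s ->
  exists tl, [/\ tchain b tl (last b [seq (c y).2 | y <- s]),
    perm_eq (verts tl) (s ++ ps ++ qs), subseq s (verts tl), all valid tl &
    {in s, forall x, sides (c x).1 tl && sides (c x).2 tl}].
Proof.
elim: s b ps qs => [|x s IH] b ps qs hs hp hq.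
  by case: ps hp => //; case: qs hq => // _ _ _ _; exists [::]; split=> /=.
have := hs [::] x s erefl => /= /andP[Ox Ix].
have hs' w1 y w2 : s = w1 ++ y :: w2 ->
    O (c y).1 y && I (last (c x).2 [seq (c z).2 | z <- w1]) y.
  by move=> E; have := hs (x :: w1) y w2; rewrite E => /(_ erefl).
case Ec: (c x) (hs') Ox => [o i] /= {}hs' Ox.
have [Eoi|Noi] := eqVneq o i.
  subst i; rewrite !xpair_eqE.
  have -> : (o == b0) && (o == ~~ b0) = false by case: (o); case: (b0).
  have -> : (o == ~~ b0) && (o == b0) = false by case: (o); case: (b0).
  move=> /= sp sq; have [tl [h1 h2 h3 h4 h5]] := IH o ps qs hs' hp hq sp sq.
  exists ((b, x, o) :: tl); split=> /=.
  - by rewrite eqxx.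
  - by rewrite perm_cons.
  - by rewrite eqxx.
  - by rewrite h4 /valid /= Ix Ox.
  move=> y; rewrite inE /sides /= => /orP[/eqP->|/h5/andP[y1 y2]]; first by rewrite Ec /= eqxx.
  by apply/andP; split; apply/orP; right.
have [Eo|No] := eqVneq o b0.
  have Ei : i = ~~ b0 by move: Noi; rewrite Eo; case: (i); case: (b0).
  subst o i; rewrite !xpair_eqE !eqxx /= (_ : (b0 == ~~ b0) = false); last by case: (b0).
  case: ps hp => //= p ps hp [sp] sq.
  have hp' : {in ps, forall v, I b0 v && O (~~ b0) v} by move=> v vp; apply: hp; rewrite inE vp orbT.
  have [tl [h1 h2 h3 h4 h5]] := IH (~~ b0) ps qs hs' hp' hq sp sq.
  exists ((b, x, b0) :: (b0, p, ~~ b0) :: tl); split=> /=.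
  - by rewrite !eqxx.
  - by apply/permP => a; move/permP/(_ a): h2; rewrite /= !count_cat /= count_cat; clear; lia.
  - by rewrite eqxx; apply: subseq_trans h3 (subseq_cons _ _).
  - by rewrite h4 /valid /= Ix Ox hp // mem_head.
  move=> y; rewrite inE /sides /= => /orP[/eqP->|/h5/andP[y1 y2]].
    by rewrite Ec /= !eqxx !orbT.
  by rewrite /sides in y1 y2; rewrite y1 y2 !orbT.
have Eo : o = ~~ b0 by move: No; case: (o); case: (b0).
have Ei : i = b0 by move: Noi; rewrite Eo; case: (i); case: (b0).
subst o i; rewrite !xpair_eqE !eqxx /= (_ : (~~ b0 == b0) = false); last by case: (b0).
case: qs hq => //= q qs hq sp [sq].
have hq' : {in qs, forall v, I (~~ b0) v && O b0 v} by move=> v vp; apply: hq; rewrite inE vp orbT.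
have [tl [h1 h2 h3 h4 h5]] := IH b0 ps qs hs' hp hq' sp sq.
exists ((b, x, ~~ b0) :: (~~ b0, q, b0) :: tl); split=> /=.
- by rewrite !eqxx.
- by apply/permP => a; move/permP/(_ a): h2; rewrite /= !count_cat /=; clear; lia.
- by rewrite eqxx; apply: subseq_trans h3 (subseq_cons _ _).
- by rewrite h4 /valid /= Ix Ox hq // mem_head.
move=> y; rewrite inE /sides /= => /orP[/eqP->|/h5/andP[y1 y2]].
  by rewrite Ec /= !eqxx !orbT.
by rewrite /sides in y1 y2; rewrite y1 y2 !orbT.
Qed.

End Typed.

Lemma next_mid (T : eqType) (s w1 w2 : seq T) x y : uniq s -> s = w1 ++ x :: y :: w2 ->
  next s x = y.
Proof. by move=> Us E; rewrite -(next_rot (size w1) Us) E rot_size_cat /= eqxx. Qed.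

Lemma next_last (T : eqType) (s : seq T) x : uniq (x :: s) -> next (x :: s) (last x s) = x.
Proof.
case/lastP: s => [|s y] U; first by rewrite /= eqxx.
rewrite last_rcons -(next_rot (size (x :: s)) U).
by rewrite -rcons_cons -cats1 rot_size_cat /= eqxx.
Qed.

(** * Arranging marks and crossing vertices *)

Section Arrange.
Variables (T : finType) (I O : bool -> pred T) (s : seq T) (U : {set T}).
Hypotheses (Us : uniq s) (sU : {in s, forall v, v \notin U}) (s3 : 2 < size s).
Hypothesis capI : forall v, I true v || I false v.
Hypothesis capO : forall v, O true v || O false v.

(* The vertices of turners b may cross from core b to core ~~ b, those of rigid b
   have to. *)
Definition turners b := [set v in U | I b v && O (~~ b) v].
Definition rigid b := [set v in U | ~~ I (~~ b) v && ~~ O b v].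
Definition straight v := (I true v && O true v) || (I false v && O false v).

Lemma rigid_turner b : rigid b \subset turners b.
Proof.
apply/subsetP => v; rewrite !inE => /and3P[-> /=].
by have := capI v; have := capO v; case: b => /=; case: (I true v); case: (I false v); case: (O true v); case: (O false v).
Qed.

Lemma rigid_disjoint b : [disjoint rigid b & turners (~~ b)].
Proof.
rewrite -setI_eq0; apply/eqP/setP => v; rewrite !inE.
by case: (v \in U) => /=; case: (I (~~ b) v); rewrite ?andbF.
Qed.

Lemma not_straight v : v \in U -> ~~ straight v -> (v \in rigid true) || (v \in rigid false).
Proof.
rewrite /straight !inE => -> /=.
by have := capI v; have := capO v; case: (I true v); case: (I false v); case: (O true v); case: (O false v).
Qed.

Definition arranged tl := [/\ exists b, tchain b tl b,
  [/\ uniq (verts tl), subseq s (verts tl) & all (valid I O) tl],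
  forall b, sides b tl,
  {in verts tl, forall v, (v \in s) || (v \in U)} &
  {in U, forall v, ~~ straight v -> v \in verts tl}].

(* c x gives the cores through which x is left and its successor in s is entered. *)
Definition turns b (c : T -> bool * bool) := count (fun x => c x == (b, ~~ b)) s.

Definition gap_ok (c : T -> bool * bool) :=
  {in s, forall x, O (c x).1 x && I (c x).2 (next s x)}.

(** The gaps consume the first [turns] vertices of X and Y; the t remaining ones on each side pair
    up into loops. The last two hypotheses ensure that the loops can be attached and that both cores
    are visited. *)
Lemma arrange_choice b0 c t (X Y : {set T}) : gap_ok c ->
  X \subset turners b0 -> Y \subset turners (~~ b0) -> [disjoint X & Y] ->
  rigid b0 \subset X -> rigid (~~ b0) \subset Y ->
  #|X| = turns b0 c + t -> #|Y| = turns (~~ b0) c + t ->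
  has (fun x => (b0 == (c x).1) || (b0 == (c x).2)) s ->
  0 < t \/ has (fun x => (~~ b0 == (c x).1) || (~~ b0 == (c x).2)) s ->
  exists2 tl, arranged tl & size tl <= size s + #|X| + #|Y|.
Proof.
move=> cok XA YA XY rX rY cX cY h0 h1.
have [x0 [s' Es]] : exists x0 s', s = x0 :: s' by case: (s) s3 => // x0 s' _; exists x0, s'.
pose z := last x0 s'; pose b := (c z).2.
have Elast : last b [seq (c y).2 | y <- s] = b by rewrite Es /= (last_map (fun y => (c y).2)).
have inX v : v \in enum X -> v \in turners b0 by rewrite mem_enum => /(subsetP XA).
have inY v : v \in enum Y -> v \in turners (~~ b0) by rewrite mem_enum => /(subsetP YA).
pose g := turns b0 c; pose g' := turns (~~ b0) c.
have szX : size (enum X) = g + t by rewrite -cardE.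
have szY : size (enum Y) = g' + t by rewrite -cardE.
have [|||||tl [h1' h2 h3 h4 h5]] := @skeleton T I O c b0 b s (take g (enum X)) (take g' (enum Y)).
- move=> w1 x w2 E; have xs : x \in s by rewrite E mem_cat mem_head orbT.
  have /andP[-> _] := cok x xs; rewrite /=.
  case/lastP: w1 E => [|w1 y] E.
    rewrite /= /b; have zs : z \in s by rewrite Es mem_last.
    have /andP[_] := cok z zs.
    have -> // : next s z = x.
    have -> : x = x0 by move: E; rewrite Es => -[].
    by rewrite Es next_last // -Es.
  rewrite map_rcons last_rcons.
  have ys : y \in s by rewrite E mem_cat mem_rcons mem_head.
  have /andP[_] := cok y ys.
  by rewrite (@next_mid T s w1 w2 y x) // E cat_rcons.
- by move=> v /mem_take/inX; rewrite inE => /andP[].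
- by move=> v /mem_take/inY; rewrite inE negbK => /andP[].
- by rewrite size_takel // szX leq_addr.
- by rewrite size_takel ?szY ?leq_addr // /g' /turns negbK.
pose lp := loops b0 (drop g (enum X)) (drop g' (enum Y)).
have szl : size (drop g (enum X)) = size (drop g' (enum Y)).
  by rewrite !size_drop szX szY !addKn.
have sd x b' : x \in s -> (b' == (c x).1) || (b' == (c x).2) -> sides b' tl.
  by move=> xs /orP[]/eqP->; case/andP: (h5 x xs).
have s0 : sides b0 tl by case/hasP: h0 => x; apply: sd.
have [tl' [k1 k2 k3]] := tchain_insert h1' (loops_chain b0 (drop g (enum X)) (drop g' (enum Y))) s0.
have PV : perm_eq (verts tl') (s ++ enum X ++ enum Y).
  rewrite (perm_trans (perm_map _ k2)) // map_cat.
  apply/permP => a; rewrite count_cat (permP h2 a) (permP (verts_loops b0 szl) a).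
  rewrite !count_cat -[in RHS](cat_take_drop g (enum X)) -[in RHS](cat_take_drop g' (enum Y)).
  by rewrite !count_cat; clear; lia.
have in_vert v : (v \in verts tl') = [|| v \in s, v \in X | v \in Y].
  by rewrite (perm_mem PV) !mem_cat !mem_enum.
have XU : X \subset U by apply: subset_trans XA _; apply/subsetP => v; rewrite inE => /andP[].
have YU : Y \subset U by apply: subset_trans YA _; apply/subsetP => v; rewrite inE => /andP[].
exists tl'; last first.
  by rewrite -(size_map (fun t => t.1.2)) (perm_size PV) !size_cat -!cardE addnA.
split.
- by exists b; rewrite Elast in k1.
- split.
  + rewrite (perm_uniq PV) !cat_uniq Us !enum_uniq andbT /= has_cat negb_or.
    apply/andP; split; last first.
      by apply/hasPn => v; rewrite !mem_enum => vY; apply: contraTN XY => vX; apply/pred0Pn; exists v; rewrite /= vX.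
    apply/andP; split; apply/hasPn => v; rewrite mem_enum => vX; apply/negP => /sU.
      by rewrite (subsetP XU).
    by rewrite (subsetP YU).
  + by apply: subseq_trans h3 (map_subseq _ k3).
  rewrite (perm_all _ k2) all_cat h4 /=.
  apply/allP => u; rewrite /lp /loops => /flatten_mapP[[p q]] pq.
  have [pX qY] : p \in enum X /\ q \in enum Y.
    have : p \in unzip1 (zip (drop g (enum X)) (drop g' (enum Y))) by apply/mapP; exists (p, q).
    have : q \in unzip2 (zip (drop g (enum X)) (drop g' (enum Y))) by apply/mapP; exists (p, q).
    by rewrite unzip1_zip ?unzip2_zip ?szl // => /mem_drop ? /mem_drop.
  rewrite !inE => /orP[]/eqP-> ; rewrite /valid /=.
    by move: (inX p pX); rewrite inE => /and3P[_ -> ->].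
  by move: (inY q qY); rewrite inE negbK => /and3P[_ -> ->].
- move=> b'; rewrite (perm_sides _ k2) /sides has_cat.
  have [->|nb] := eqVneq b' b0; first by rewrite -/(sides b0 tl) s0.
  have -> : b' = ~~ b0 by move: nb; case: (b'); case: (b0).
  case: h1 => [t0|/hasP[x xs]]; last by move=> hx; rewrite -/(sides _ tl) (sd x).
  apply/orP; right; rewrite /loops.
  have : 0 < size (drop g' (enum Y)) by rewrite size_drop szY addKn.
  have : 0 < size (drop g (enum X)) by rewrite size_drop szX addKn.
  by case: (drop g _) => // p ?; case: (drop g' _) => // q ?; rewrite /= eqxx.
- by move=> v; rewrite in_vert => /or3P[->//|/(subsetP XU)->|/(subsetP YU)->]; rewrite orbT.
move=> v vU /(not_straight vU) hv; rewrite in_vert.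
have : (v \in rigid b0) || (v \in rigid (~~ b0)) by move: hv; case: (b0) => //=; rewrite orbC.
by case/orP => [/(subsetP rX)->|/(subsetP rY)->]; rewrite !orbT.
Qed.

Lemma arrange_card b0 c t : gap_ok c ->
  #|rigid b0| <= turns b0 c + t <= #|turners b0| ->
  #|rigid (~~ b0)| <= turns (~~ b0) c + t <= #|turners (~~ b0)| ->
  turns b0 c + turns (~~ b0) c + t.*2 <= #|turners b0 :|: turners (~~ b0)| ->
  t <= (#|rigid b0| + #|rigid (~~ b0)|).+1 ->
  has (fun x => (b0 == (c x).1) || (b0 == (c x).2)) s ->
  0 < t \/ has (fun x => (~~ b0 == (c x).1) || (~~ b0 == (c x).2)) s ->
  exists2 tl, arranged tl &
    size tl <= 3 * size s + 2 * (#|rigid true| + #|rigid false|).+1.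
Proof.
move=> cok h0 h1 h2 ht hs0 hs1.
have dis1 := rigid_disjoint (~~ b0); rewrite negbK in dis1.
have [|X [Y [[rX XA rY YA] [dXY cX cY]]]] := pick_disjoint (rigid_turner b0)
  (rigid_turner (~~ b0)) (rigid_disjoint b0) dis1 h0 h1.
  by move: h2; clear; lia.
have [tl atl stl] := arrange_choice cok XA YA dXY rX rY cX cY hs0 hs1.
exists tl => //; apply: leq_trans stl _; rewrite cX cY.
have : turns b0 c <= size s by apply: count_size.
have : turns (~~ b0) c <= size s by apply: count_size.
have -> : #|rigid true| + #|rigid false| = #|rigid b0| + #|rigid (~~ b0)|.
  by case: (b0); rewrite //= addnC.
by move: ht; clear; lia.
Qed.

(* Sum of two abilities: a turner of direction b has flux 2, a vertex that must
   cross the other way has flux 0. *)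
Definition flux b v : nat := O (~~ b) v + I b v.

Definition gap_sum b := \sum_(x <- s) (O (~~ b) x + I b (next s x)).

Lemma gap_sumE b : gap_sum b = \sum_(x <- s) flux b x.
Proof.
rewrite /gap_sum /flux !big_split /=; congr (_ + _).
rewrite -(big_map (next s) xpredT (fun x => nat_of_bool (I b x))).
apply: perm_big; apply: uniq_perm => //.
  by rewrite (map_inj_uniq (can_inj (prev_next Us))).
move=> x; apply/mapP/idP => [[y ys ->]|xs]; first by rewrite mem_next.
by exists (prev s x); rewrite ?mem_prev // next_prev.
Qed.

Hypothesis enough : forall b,
  #|U| + (size s).*2 <= \sum_(v in U) flux b v + \sum_(v <- s) flux b v.

(** Over the free vertices, flux counts 1 each, plus 1 per turner of direction b, minus 1 per vertex
    of [rigid (~~ b)]; the rest is [enough]. *)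
Lemma turners_ge b : (size s).*2 + #|rigid (~~ b)| <= #|turners b| + gap_sum b.
Proof.
have H : \sum_(v in U) flux b v + #|rigid (~~ b)| <= #|U| + #|turners b|.
  have E (Z : pred T) : #|[set v in U | Z v]| = \sum_(v in U) Z v.
    rewrite -sum1_card big_mkcond [RHS]big_mkcond.
    by apply: eq_bigr => v _; rewrite inE; case: (v \in U); case: (Z v).
  rewrite !E -sum1_card -!big_split /=; apply: leq_sum => v _; rewrite /flux negbK.
  by case: (I b v); case: (O (~~ b) v).
by move: (enough b) H; rewrite gap_sumE; clear; lia.
Qed.

(** A gap crossed in direction b contributes 0 to [gap_sum b], any gap at most 2. With [turners_ge]
    this gives two turners for each gap that needs one, which makes up for vertices that are turners
    of both directions. *)
Lemma gap_sum_turns b c :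
  {in s, forall x, c x = (b, ~~ b) -> ~~ O (~~ b) x && ~~ I b (next s x)} ->
  gap_sum b + (turns b c).*2 <= (size s).*2.
Proof.
move=> hc; rewrite /turns -sum1_count -!muln2 big_distrl /= -[size s]sum1_size.
rewrite big_distrl /= [X in _ + X]big_mkcond -big_split /= big_seq [X in _ <= X]big_seq.
apply: leq_sum => x xs; case: eqP => [/(hc x xs)/andP[/negPf-> /negPf->]//|_].
by case: (O _ _); case: (I _ _).
Qed.

Lemma turners_union b : [/\ #|turners b| + #|turners (~~ b)| <= 2 * #|turners b :|: turners (~~ b)|,
  #|rigid b| + #|turners (~~ b)| <= #|turners b :|: turners (~~ b)|,
  #|rigid (~~ b)| + #|turners b| <= #|turners b :|: turners (~~ b)|,
  #|rigid b| <= #|turners b| & #|rigid (~~ b)| <= #|turners (~~ b)|].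
Proof.
have sub (A B C : {set T}) : A \subset C -> B \subset C -> [disjoint A & B] ->
    #|A| + #|B| <= #|C|.
  move=> AC BC dAB; have := cardsUI A B; move: dAB; rewrite -setI_eq0 => /eqP->.
  rewrite cards0 addn0 => <-; apply/subset_leq_card; rewrite subUset AC //.
have rt := rigid_turner b; have rf := rigid_turner (~~ b).
split; try exact: subset_leq_card.
- have := subset_leq_card (subsetUl (turners b) (turners (~~ b))).
  have := subset_leq_card (subsetUr (turners b) (turners (~~ b))).
  by clear; lia.
- apply: sub; rewrite ?rigid_disjoint ?subsetUr //; exact: subset_trans rt (subsetUl _ _).
have d := rigid_disjoint (~~ b); rewrite negbK in d.
apply: sub; rewrite ?subsetUl //; exact: subset_trans rf (subsetUr _ _).
Qed.

Definition common b x := O b x && I b (next s x).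

(* A gap is bridged inside a single core whenever possible. *)
Definition default x : bool * bool :=
  if common true x then (true, true) else if common false x then (false, false)
  else if O true x then (true, false) else (false, true).

Lemma default_ok : gap_ok default.
Proof.
move=> x _; rewrite /default /common.
have := capI (next s x); have := capO x.
by case E1: (O true x); case E2: (O false x); case E3: (I true _); case E4: (I false _); rewrite /= ?(E1, E2, E3, E4).
Qed.

Lemma default_turns b : gap_sum b + (turns b default).*2 <= (size s).*2.
Proof.
apply: gap_sum_turns => x _; rewrite /default /common.
have := capI (next s x); have := capO x.
by case: b; case: (O true x); case: (O false x); case: (I true _); case: (I false _).
Qed.

(* Unless the default choices visit both cores already, all of them use the same
   core b, and a detour to the other core is added. *)
Theorem arrange_exists : exists2 tl, arranged tl &
  size tl <= 3 * size s + 2 * (#|rigid true| + #|rigid false|).+1.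
Proof.
have K := turners_ge; have D := default_turns.
pose seen (b : bool) := has (fun x => (b == (default x).1) || (b == (default x).2)) s.
have main (b : bool) : seen b -> seen (~~ b) -> exists2 tl, arranged tl &
    size tl <= 3 * size s + 2 * (#|rigid true| + #|rigid false|).+1.
  move=> sb snb; have [u1 u2 u3 u4 u5] := turners_union b.
  have kb := K b; have knb := K (~~ b); have db := D b; have dnb := D (~~ b).
  rewrite negbK in knb.
  (* The least surplus for which both chosen sets can contain all forced crossings. *)
  pose t := maxn (#|rigid b| - turns b default) (#|rigid (~~ b)| - turns (~~ b) default).
  apply: (arrange_card (b0 := b) (t := t) default_ok) => //; rewrite /t.
  - by move: u1 u2 u3 u4 u5 kb knb db dnb; clear; lia.
  - by move: u1 u2 u3 u4 u5 kb knb db dnb; clear; lia.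
  - by move: u1 u2 u3 u4 u5 kb knb db dnb; clear; lia.
  - by clear; lia.
  by right.
have [x0 x0s] : exists x0, x0 \in s.
  by case: (s) s3 => // x0 s' _; exists x0; rewrite mem_head.
pose b := (default x0).1.
have sb : seen b by apply/hasP; exists x0; rewrite // /b eqxx.
have [snb|nsnb] := boolP (seen (~~ b)); first exact: main sb snb.
have allb x : x \in s -> default x = (b, b).
  move=> xs; move/hasPn/(_ x xs): nsnb; rewrite [default x]surjective_pairing.
  by case: (default x).1; case: (default x).2; case: (b).
have comb x : x \in s -> O b x /\ I b (next s x).
  by move=> xs; have /andP := default_ok xs; rewrite allb.
pose cx (p q : bool) (x1 x : T) := if x == x1 then (p, q) else (b, b).
have cx_turns p q x1 b' : x1 \in s -> turns b' (cx p q x1) = ((p, q) == (b', ~~ b')).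
  move=> x1s; have nb : ((b, b) == (b', ~~ b')) = false by case: (b); case: (b').
  rewrite /turns (eq_count (a2 := fun x => (x == x1) && ((p, q) == (b', ~~ b')))).
    case: eqP => _; last by rewrite (eq_count (a2 := pred0)) ?count_pred0 // => x; rewrite andbF.
    by rewrite (eq_count (a2 := pred1 x1)) ?count_uniq_mem ?x1s // => x; rewrite andbT.
  by move=> x; rewrite /cx; case: (x == x1).
have cx_ok p q x1 : O p x1 -> I q (next s x1) -> gap_ok (cx p q x1).
  move=> hO hI x xs; rewrite /cx; case: eqP => [->|_] /=; first by rewrite hO hI.
  by have [-> ->] := comb x xs.
have cx_seen p q x1 : has (fun x => (b == (cx p q x1 x).1) || (b == (cx p q x1 x).2)) s.
  have [x2 x2s x21] : exists2 x2, x2 \in s & x2 != x1.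
    move: s3 Us; case: (s) => [|y1 [|y2 s']] //= _ /andP[y12 _].
    have [E|] := eqVneq y1 x1; last by exists y1; rewrite // mem_head.
    exists y2; rewrite ?inE ?eqxx ?orbT // -E.
    by apply: contraNneq y12 => <-; rewrite mem_head.
  by apply/hasP; exists x2; rewrite // /cx (negPf x21) eqxx.
have [u1 u2 u3 u4 u5] := turners_union b.
have kb := K b; have knb := K (~~ b); rewrite negbK in knb.
pose r := maxn #|rigid b| #|rigid (~~ b)|.
have gle b' : gap_sum b' <= (size s).*2 by apply: leq_trans (D b'); rewrite leq_addr.
(* A gap that can also be bridged in the other core is moved there; no gap then needs a crossing
   vertex. *)
have [/hasP[x1 x1s /andP[h1 h2]]|none] := boolP (has (common (~~ b)) s).
  have E1 : ((~~ b, ~~ b) == (b, ~~ b)) = false by case: (b).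
  have E2 : ((~~ b, ~~ b) == (~~ b, ~~ ~~ b)) = false by case: (b).
  apply: (arrange_card (b0 := b) (t := r) (cx_ok _ _ _ h1 h2)); rewrite ?cx_turns // ?E1 ?E2.
  - by move: u1 u2 u3 u4 u5 kb knb (gle b) (gle (~~ b)); clear; lia.
  - by move: u1 u2 u3 u4 u5 kb knb (gle b) (gle (~~ b)); clear; lia.
  - by move: u1 u2 u3 u4 u5 kb knb (gle b) (gle (~~ b)); clear; lia.
  - by clear; lia.
  by right; apply/hasP; exists x1; rewrite // /cx eqxx /= eqxx.
pose m1 := count (O (~~ b)) s; pose m2 := count (fun x => I (~~ b) (next s x)) s.
have cE (a : pred T) : count a s = \sum_(x <- s) a x.
  by rewrite -sum1_count big_mkcond; apply: eq_bigr => x _; case: (a x).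
have m12 : m1 + m2 <= size s.
  rewrite /m1 /m2 !cE -[size s]sum1_size -big_split /=.
  rewrite big_seq [X in _ <= X]big_seq; apply: leq_sum => x xs.
  by move/hasPn/(_ x xs): none; rewrite /common; case: (O _ x); case: (I _ _).
have g1 : gap_sum b <= size s + m1.
  rewrite /m1 cE -[size s]sum1_size -big_split /=.
  by apply: leq_sum => x _; case: (O _ x); case: (I _ _).
have g2 : gap_sum (~~ b) <= size s + m2.
  rewrite /m2 cE -[size s]sum1_size -big_split /=.
  by apply: leq_sum => x _; case: (O _ x); case: (I _ _).
(* If all marks can be left towards the other core, one gap starts there and comes back over a
   vertex of [turners (~~ b)]. That vertex already covers one forced crossing, whence the
   predecessor in t. *)
have [h1|h1] := ltnP m1 (size s); last first.
  have hO : O (~~ b) x0.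
    have : all (O (~~ b)) s by rewrite all_count eqn_leq count_size.
    by move/allP; apply.
  have [_ hI] := comb x0 x0s.
  have E1 : ((~~ b, b) == (b, ~~ b)) = false by case: (b).
  have E2 : ((~~ b, b) == (~~ b, ~~ ~~ b)) = true by case: (b).
  apply: (arrange_card (b0 := b) (t := maxn #|rigid b| #|rigid (~~ b)|.-1) (cx_ok _ _ _ hO hI)); rewrite ?cx_turns // ?E1 ?E2.
  - by move: s3 h1 u1 u2 u3 u4 u5 kb knb g1 g2 m12; clear; lia.
  - by move: s3 h1 u1 u2 u3 u4 u5 kb knb g1 g2 m12; clear; lia.
  - by move: s3 h1 u1 u2 u3 u4 u5 kb knb g1 g2 m12; clear; lia.
  - by clear; lia.
  by right; apply/hasP; exists x0; rewrite // /cx eqxx /= eqxx.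
have [h2|h2] := ltnP m2 (size s); last first.
  have hI : I (~~ b) (next s x0).
    have : all (fun x => I (~~ b) (next s x)) s by rewrite all_count eqn_leq count_size.
    by move/allP; apply.
  have [hO _] := comb x0 x0s.
  have E1 : ((b, ~~ b) == (b, ~~ b)) = true by case: (b).
  have E2 : ((b, ~~ b) == (~~ b, ~~ ~~ b)) = false by case: (b).
  apply: (arrange_card (b0 := b) (t := maxn #|rigid b|.-1 #|rigid (~~ b)|) (cx_ok _ _ _ hO hI)); rewrite ?cx_turns // ?E1 ?E2.
  - by move: s3 h2 u1 u2 u3 u4 u5 kb knb g1 g2 m12; clear; lia.
  - by move: s3 h2 u1 u2 u3 u4 u5 kb knb g1 g2 m12; clear; lia.
  - by move: s3 h2 u1 u2 u3 u4 u5 kb knb g1 g2 m12; clear; lia.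
  - by clear; lia.
  by right; apply/hasP; exists x0; rewrite // /cx eqxx /= eqxx orbT.
have def_turns b' : turns b' default = 0.
  apply/eqP; rewrite -leqn0 leqNgt -has_count; apply/hasPn => x xs; rewrite allb //.
  by case: (b); case: (b').
(* Here k >= 3 is essential: the two directions have together at least 2k - m1 - m2 >= k >= 3
   turners, so at least two distinct vertices are available for a loop. *)
apply: (arrange_card (b0 := b) (t := maxn 1 r) default_ok); rewrite ?def_turns /r //.
- by move: h1 h2 s3 u1 u2 u3 u4 u5 kb knb g1 g2 m12; clear; lia.
- by move: h1 h2 s3 u1 u2 u3 u4 u5 kb knb g1 g2 m12; clear; lia.
- by move: h1 h2 s3 u1 u2 u3 u4 u5 kb knb g1 g2 m12; clear; lia.
- by clear; lia.
by left; rewrite leq_max.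
Qed.

End Arrange.

(** * Joining pieces through the cores and inserting the remaining vertices *)

Fixpoint npair (T : Type) (Z : pred T) x l : nat :=
  if l is y :: l' then (Z x && Z y) + npair Z y l' else 0.

Lemma npair_cat (T : Type) (Z : pred T) x l1 l2 :
  npair Z x (l1 ++ l2) = npair Z x l1 + npair Z (last x l1) l2.
Proof. by elim: l1 x => //= y l IH x; rewrite IH addnA. Qed.

Section Cores.
Variables (T : finType) (e : rel T) (core : bool -> {set T}) (G tau : nat).
Hypothesis irr : irreflexive e.
Hypothesis core_disj : forall b v, v \in core b -> v \notin core (~~ b).
Hypothesis core_out : forall b v, v \in core b -> #|[set w in core b | ~~ e v w]| <= G.
Hypothesis core_in : forall b v, v \in core b -> #|[set w in core b | ~~ e w v]| <= G.

Definition capout b v := tau <= #|[set w in core b | e v w]|.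
Definition capin b v := tau <= #|[set w in core b | e w v]|.

(** x and x' are chosen first, then m among the common neighbours in the core. Three inner vertices
    guarantee the arc x -> m inside core b, a slot for later insertions. *)
Lemma connect3 a a' b (F : {set T}) : capout b a -> capin b a' ->
  #|F| + 2 * G + 3 <= tau -> exists x m x',
  [/\ path e a [:: x; m; x'; a'], uniq [:: x; m; x'],
      {in [:: x; m; x'], forall y, y \notin F}, x \in core b & m \in core b].
Proof.
rewrite /capout /capin => ca ca' hF.
have [x] : exists x, x \in [set w in core b | e a w] :\: F.
  apply/card_gt0P; have := card_setD_ge [set w in core b | e a w] F.
  by move: ca hF; clear; lia.
rewrite !inE => /and3P[xF xb ax].
have [x'] : exists x', x' \in [set w in core b | e w a'] :\: (x |: F).
  apply/card_gt0P; have := card_setD_ge [set w in core b | e w a'] (x |: F).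
  by move: ca' hF; rewrite cardsU1; move: (_ \notin _) => z; clear; lia.
rewrite !inE negb_or => /andP[/andP[x'x x'F] /andP[x'b x'a']].
pose N := [set w in core b | ~~ e x w] :|: [set w in core b | ~~ e w x'].
have [m] : exists m, m \in core b :\: (x |: (x' |: (F :|: N))).
  apply/card_gt0P; have := card_setD_ge (core b) (x |: (x' |: (F :|: N))).
  have : #|core b| >= tau.
    by apply: leq_trans ca _; apply/subset_leq_card/subsetP => w; rewrite inE => /andP[].
  have : #|x |: (x' |: (F :|: N))| <= 2 + (#|F| + (G + G)).
    rewrite !cardsU1 -[2]/(1 + 1) -!addnA !leq_add ?leq_b1 //.
    apply: leq_trans (leq_card_setU _ _).1 _; rewrite leq_add2l.
    apply: leq_trans (leq_card_setU _ _).1 _; rewrite leq_add //.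
      exact: core_out.
    exact: core_in.
  by move: hF; move: #|_ |: _| #|_ :\: _|; clear; lia.
rewrite !inE !negb_or !negb_and !negbK => /andP[/and4P[mx mx' mF /andP[h1 h2]] mb].
rewrite mb /= in h1 h2; exists x, m, x'; split=> //.
- by rewrite /= ax h1 h2 x'a'.
- by rewrite /= !inE !negb_or eq_sym mx eq_sym x'x mx'.
by move=> y; rewrite !inE => /or3P[]/eqP->.
Qed.

(** Pieces are paths rather than single vertices, since a vertex may travel with private
    neighbours. *)
Definition goodpiece (t : bool * seq T * bool) :=
  if t.1.2 is h :: r then [&& path e h r, capin t.1.1 h & capout t.2 (last h r)] else false.

(** As in [link_path], with the slots counted in addition: each junction through a core leaves one
    arc x -> m inside it. *)
Lemma connect_pieces (tl : seq (bool * seq T * bool)) a b c (F : {set T}) :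
  a \in F -> capout b a -> tchain b tl c -> all goodpiece tl ->
  uniq (flatten (verts tl)) -> {subset flatten (verts tl) <= F} ->
  #|F| + 3 * size tl + 2 * G + 3 <= tau ->
  exists l, [/\ path e a l, last a l = last a (flatten (verts tl)), uniq l,
    [seq y <- l | y \in F] = flatten (verts tl) &
    forall b', count (fun t => t.1.1 == b') tl <= npair [in core b'] a l].
Proof.
elim: tl a b F => [|[[bi [//|h r]] bo] tl IH] a b F aF ca; first by exists [::]; split.
move=> /= /andP[/eqP Ebi tc] /andP[/and3P[/= pr ch cl] gt].
case/andP=> hn.
rewrite cat_uniq => /and3P[Ur rd Ut] sF hF; subst bi.
have hFF : h \in F by apply: sF; rewrite mem_head.
have rF y : y \in r -> y \in F by move=> yr; apply: sF; rewrite inE mem_cat yr orbT.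
have tF y : y \in flatten (verts tl) -> y \in F.
  by move=> yr; apply: sF; rewrite inE mem_cat yr !orbT.
have [|x [m [x' [px Ux xF xb mb]]]] := @connect3 a h b F ca ch.
  by move: hF; clear; lia.
pose F' := F :|: [set y in [:: x; m; x']].
have cF' : #|F'| <= #|F| + 3.
  apply: leq_trans (leq_card_setU _ _).1 _; rewrite leq_add2l.
  by rewrite cardsE (leq_trans (card_size _)).
have [|||l [pl ll Ul fl hl]] := IH (last h r) bo F' _ cl tc gt Ut.
- rewrite inE; apply/orP; left; case: (r) rF => [|y r'] rF //=.
  by apply: rF; rewrite mem_last.
- by move=> y /tF yF; rewrite inE yF.
- by move: hF cF'; move: #|F'| => f; clear; lia.
have mem_l y : y \in l -> y \in F' -> y \in flatten (verts tl).
  by move=> yl yF; rewrite -fl mem_filter yF yl.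
have l_new y : y \in [:: x; m; x'] -> y \notin l.
  move=> yx; apply/negP => yl; have : y \in F by apply: tF; apply: mem_l => //; rewrite !inE in yx *; rewrite yx orbT.
  by apply/negP/xF.
have hr_new y : y \in h :: r -> y \notin l.
  move=> yr; apply/negP => yl.
  have yF : y \in F by move: yr; rewrite inE => /orP[/eqP->|/rF].
  have yt : y \in flatten (verts tl) by apply: mem_l => //; rewrite inE yF.
  move: yr; rewrite inE => /orP[/eqP E|yr].
    by move: hn; rewrite mem_cat -E yt orbT.
  by case/hasP: rd; exists y.
exists ([:: x; m; x'] ++ (h :: r) ++ l); split.
- move: px; rewrite /= => /and5P[-> -> -> -> _] /=.
  by rewrite cat_path pr pl.
- by rewrite /= !last_cat ll.
- have Uhr : uniq (h :: r) by rewrite cons_uniq Ur andbT; apply: contra hn; rewrite mem_cat => ->.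
  have Uhl : uniq ((h :: r) ++ l).
    rewrite cat_uniq Uhr Ul andbT; apply/hasPn => y yl; apply/negP => /hr_new.
    by rewrite yl.
  rewrite cat_uniq Ux Uhl andbT; apply/hasPn => y; rewrite mem_cat => /orP[yr|yl].
    apply/negP => /xF; apply/negP; rewrite negbK.
    by move: yr; rewrite inE => /orP[/eqP->|/rF].
  by apply/negP => /l_new; rewrite yl.
- rewrite !filter_cat.
  have -> : [seq y <- [:: x; m; x'] | y \in F] = [::].
    by apply/eqP; rewrite -(negbK (_ == _)) -has_filter; apply/hasPn => y /xF.
  have /all_filterP -> : all [in F] (h :: r) by apply/allP => y; rewrite inE => /orP[/eqP->|/rF].
  rewrite /=; congr (_ :: (_ ++ _)).
  have /all_filterP sfix : all [in F] (flatten (verts tl)) by apply/allP => y /tF.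
  rewrite -[RHS]sfix -[in RHS]fl -filter_predI.
  by apply: eq_filter => y /=; rewrite !inE; case: (y \in F).
move=> b'; rewrite /= npair_cat; have hb := hl b'.
have : (b == b') <= (x \in core b') && (m \in core b').
  by case: eqP => // <-; rewrite xb mb.
move=> hq; apply: leq_trans (leq_add hq hb) _.
move: (npair _ _ l) (npair _ _ r) => A B; do 4!move: (nat_of_bool _) => ?.
by clear; lia.
Qed.

Lemma core_eq b b' v : v \in core b -> v \in core b' -> b = b'.
Proof.
by move=> vb; apply: contraTeq => nb; have := core_disj vb; move: nb; case: b {vb}; case: b'.
Qed.

(** A slot that cannot take z starts at a non-in-neighbour or ends at a non-out-neighbour of z, so
    it contributes to [pairs]. *)
Lemma find_slot b z a l : z \in core b ->
  (exists W y w, [/\ l = W ++ y :: w, last a W \in core b, y \in core b,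
     e (last a W) z & e z y]) \/
  npair [in core b] a l <=
    pairs [pred x | (x \in core b) && ~~ e x z] [pred y | (y \in core b) && ~~ e z y] a l.
Proof.
move=> zb; elim: l a => [|y l IH] a /=; first by right.
case: (IH y) => [[W [y' [w [-> h1 h2 h3 h4]]]]|IHl].
  by left; exists (y :: W), y', w.
have [/and4P[h1 h2 h3 h4]|] := boolP [&& a \in core b, y \in core b, e a z & e z y].
  by left; exists [::], y, l.
move=> h; right; apply: leq_add => //; move: h.
by case: (a \in _) => //; case: (y \in _) => //=; case: (e a z); case: (e z y).
Qed.

(* Fewer than 2G + 1 consecutive pairs inside core b fail to accommodate z. *)
Lemma insert_core b z a l : path e a l -> last a l = a -> uniq l -> z \notin l ->
  z \in core b -> 2 * G < npair [in core b] a l ->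
  exists l', [/\ path e a l' /\ last a l' = a, uniq l', perm_eq l' (z :: l),
    subseq l l' & forall b', npair [in core b'] a l <= npair [in core b'] a l'].
Proof.
move=> pl ll Ul zl zb hG; case: (find_slot a l zb) => [|h]; last first.
  have c1 (Z : pred T) (S : {set T}) : (forall w, Z w -> w \in S) -> count Z l <= #|S|.
    move=> ZS; rewrite -size_filter -(card_uniqP (filter_uniq Z Ul)).
    by apply/subset_leq_card/subsetP => w; rewrite mem_filter => /andP[/ZS].
  move: h; rewrite pairsE (permP (perm_belast ll)) => h.
  suff : npair [in core b] a l <= G + G by move: hG; clear; lia.
  apply: leq_trans h (leq_add _ _).
    by apply: leq_trans (core_in zb); apply: c1 => w /=; rewrite inE.
  by apply: leq_trans (core_out zb); apply: c1 => w /=; rewrite inE.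
move=> [W [y [w [El h1 h2 h3 h4]]]]; exists (W ++ z :: y :: w).
have PE : perm_eq (W ++ z :: y :: w) (z :: l).
  by rewrite El -[z :: y :: w]cat1s perm_catCA.
split=> //.
- split; last by rewrite -[RHS]ll El !last_cat.
  by move: pl; rewrite El !cat_path /= h3 h4 => /and3P[-> _ ->].
- by rewrite (perm_uniq PE) cons_uniq zl.
- by rewrite El cat_subseq // subseq_cons.
move=> b'; rewrite El !npair_cat /= leq_add2l addnA leq_add2r.
case E: (_ && _) => //; case/andP: E => lb _.
by rewrite lb -(core_eq h1 lb) zb.
Qed.

(** No insertion lowers the number of slots of either core, so the supply above 2G lasts to the
    end. *)
Lemma insert_all a l : path e a l -> last a l = a -> uniq l ->
  (forall v, v \notin l -> exists b, v \in core b) ->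
  (forall b, 2 * G < npair [in core b] a l) ->
  exists l', [/\ path e a l', last a l' = a, uniq l', forall v, v \in l' & subseq l l'].
Proof.
have [n] := ubnP #|~: [set y in l]|; elim: n l => // n IH l hn pl ll Ul hc hG.
have [v|allv] := pickP [pred v | v \notin l]; last first.
  by exists l; split=> // v; move: (allv v) => /= /negbFE.
move=> /= vl; have [b vb] := hc v vl.
have [l' [[pl' ll'] Ul' PE S' h']] := insert_core pl ll Ul vl vb (hG b).
have [||||||l2 [p2 l2l U2 a2 S2]] := IH l' => //.
- have sub : ~: [set y in l'] \subset (~: [set y in l]) :\ v.
    by apply/subsetP => y; rewrite !inE (perm_mem PE) inE negb_or.
  move: hn (subset_leq_card sub); rewrite (cardsD1 v (~: _)) !inE vl.
  by clear; lia.
- by move=> w; rewrite (perm_mem PE) inE negb_or => /andP[_ /hc].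
- by move=> b'; apply: leq_trans (hG b') (h' b').
by exists l2; split=> //; apply: subseq_trans S2.
Qed.

Lemma tchain_last b (tl : seq (bool * seq T * bool)) t c : tchain b (rcons tl t) c -> t.2 = c.
Proof. by elim: tl b => [|u tl IH] b /= /andP[_]; [move/eqP | exact: IH]. Qed.

Theorem complete_pieces (tl : seq (bool * seq T * bool)) b : tchain b tl b -> all goodpiece tl ->
  uniq (flatten (verts tl)) -> size (flatten (verts tl)) + 3 * size tl + 2 * G + 3 <= tau ->
  (forall v, v \notin flatten (verts tl) -> exists b', v \in core b') ->
  (forall b', 2 * G < count (fun t => t.1.1 == b') tl) ->
  exists l, ham_cycle e l /\ subseq (flatten (verts tl)) l.
Proof.
move=> tc gt Ut hs hc hG.
have [tl0 [[[bi p] bo] Etl]] : exists tl0 t, tl = rcons tl0 t.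
  case/lastP: (tl) (hG b) => //= tl0 t _; by exists tl0, t.
have Ebo : bo = b by move: tc; rewrite Etl => /tchain_last.
have [h [r Ep]] : exists h r, p = h :: r.
  move: gt; rewrite Etl all_rcons => /andP[]; rewrite /goodpiece /=; case: (p) => // h r _ _.
  by exists h, r.
have Efl : flatten (verts tl) = flatten (verts tl0) ++ h :: r.
  by rewrite Etl /verts map_rcons flatten_rcons Ep.
pose a := last h r; have ca : capout b a.
  move: gt; rewrite Etl all_rcons => /andP[]; rewrite /goodpiece /= Ep -Ebo.
  by case/and3P.
have [|||l [pl ll Ul fl hl]] := @connect_pieces tl a b b [set y in flatten (verts tl)] _ ca tc gt Ut.
- by rewrite inE Efl mem_cat mem_last orbT.
- by move=> y; rewrite inE.
- by rewrite cardsE (card_uniqP Ut).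
have ll' : last a l = a by rewrite ll Efl last_cat.
have sub1 : subseq (flatten (verts tl)) l by rewrite -fl filter_subseq.
have [||l' [pl' ll2 Ul' al' S']] := insert_all pl ll' Ul.
- move=> v vl; apply: hc; apply: contra vl; exact: mem_subseq sub1 v.
- by move=> b'; apply: leq_trans (hG b') (hl b').
exists l'; split; last exact: subseq_trans S'.
split=> //; case: l' pl' ll2 {Ul' S'} al' => [|y l'] /=; first by move=> _ _ /(_ a).
by move=> /andP[ay pl'] ll2 _; rewrite rcons_path pl' ll2 ay.
Qed.

End Cores.

Lemma match_list (T : finType) (r : rel T) (Lf Rt Z : {set T}) beta tau N :
  {in Lf, forall x, beta <= #|[set y in Rt | r x y]|} ->
  {in Rt, forall y, #|[set x in Lf | r x y]| <= tau} ->
  (N + #|Z|) * tau < (#|Lf| - N) * beta ->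
  exists prs : seq (T * T), [/\ size prs = N, uniq (unzip1 prs), uniq (unzip2 prs) &
    {in prs, forall p, [&& p.1 \in Rt, p.1 \notin Z, p.2 \in Lf & r p.2 p.1]}].
Proof.
move=> hL hR; elim: N => [|N IH] hN; first by exists [::].
have [|prs [sp U1 U2 hp]] := IH.
  apply: leq_ltn_trans (leq_trans hN _); rewrite ?leq_mul2r.
    by apply/orP; right; lia.
  by apply/orP; right; lia.
pose L' := Lf :\: [set x in unzip2 prs]; pose R' := Rt :&: (Z :|: [set y in unzip1 prs]).
have cL' : #|Lf| - N <= #|L'|.
  have := card_setD_ge Lf [set x in unzip2 prs].
  have : #|[set x in unzip2 prs]| <= N by rewrite cardsE (leq_trans (card_size _)) // size_map sp.
  by rewrite -/L'; clear; lia.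
have cR' : #|R'| <= N + #|Z|.
  have : #|R'| <= #|Z :|: [set y in unzip1 prs]| by rewrite subset_leq_card // subsetIr.
  have := (leq_card_setU Z [set y in unzip1 prs]).1.
  have : #|[set x in unzip1 prs]| <= N by rewrite cardsE (leq_trans (card_size _)) // size_map sp.
  by move: #|_ :|: _|; clear; lia.
have [p /and5P[h1 h2 h3 h4 h5]|none] := pickP [pred p : T * T | [&& p.1 \in Rt,
    p.1 \notin Z :|: [set y in unzip1 prs], p.2 \in Lf, p.2 \notin unzip2 prs & r p.2 p.1]].
  exists (p :: prs); move: h2; rewrite !inE negb_or => /andP[pZ pU].
  split=> /=; rewrite ?sp ?U1 ?U2 ?pU ?h4 // => q; rewrite inE => /orP[/eqP->|/hp//].
  by rewrite h1 pZ h3 h5.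
have up : \sum_(x in L') #|[set y in Rt | r x y]| <= \sum_(y in R') #|[set x in Lf | r x y]|.
  apply: leq_trans (_ : \sum_(y in R') #|[set x in L' | r x y]| <= _); last first.
    by apply: leq_sum => y _; apply/subset_leq_card/subsetP => x; rewrite !inE => /andP[/andP[_ ->] ->].
  rewrite -(sum_card_swap L' R' r); apply: leq_sum => x xL.
  apply/subset_leq_card/subsetP => y; rewrite inE => /andP[yR rxy].
  rewrite inE rxy andbT inE yR /=; apply: contraFT (none (y, x)) => yn.
  by move: xL; rewrite /= yR yn rxy !inE andbT => /andP[-> ->].
have low : #|L'| * beta <= \sum_(x in L') #|[set y in Rt | r x y]|.
  by rewrite -sum_nat_const; apply: leq_sum => x; rewrite inE => /andP[_ /hL].
have high : \sum_(y in R') #|[set x in Lf | r x y]| <= #|R'| * tau.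
  by rewrite -sum_nat_const; apply: leq_sum => x; rewrite inE => /andP[/hR].
have := leq_trans low (leq_trans up high); move: hN cL' cR'.
move: #|L'| #|R'| #|Lf| #|Z| => l' r' l z; clear=> hN cl cr hb.
have : (l - N.+1) * beta <= (N.+1 + z) * tau.
  apply: leq_trans (leq_trans hb _); rewrite leq_mul2r; apply/orP; right; lia.
by move: hN; lia.
Qed.

(** * Private neighbours making up for missing abilities *)

Section AugmentIn.
Variables (T : finType) (e : rel T) (core : bool -> {set T}) (G tau d k n : nat).
Hypothesis irr : irreflexive e.
Hypothesis degO : forall v, d <= dout e setT v.
Hypothesis core_disj : forall b v, v \in core b -> v \notin core (~~ b).
Hypothesis core_big : forall b, n <= 2 * (#|core b| + G).
Hypothesis core_in : forall b v, v \in core b -> capin e core tau b v.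
Hypothesis core_out : forall b v, v \in core b -> capout e core tau b v.
Hypothesis kG : k <= G.
Hypothesis large : (4 * k + 2) * tau + 40 * G < n./2.

Notation cin := (capin e core tau).
Notation cout := (capout e core tau).

(** The flux of direction b summed over all vertices, before any private neighbour is attached. *)
Definition pool b := #|[set v | cout (~~ b) v]| + #|[set v | cin b v]|.

Lemma card_cores b : n <= #|core b| + #|core (~~ b)| + 2 * G.
Proof. by move: (core_big b) (core_big (~~ b)); clear; lia. Qed.

Lemma card_cap b (Z : pred T) : {in core (~~ b), forall v, Z v} ->
  #|core (~~ b)| + #|[set v in core b | Z v]| <= #|[set v | Z v]|.
Proof.
move=> hZ; have := cardsUI (core (~~ b)) [set v in core b | Z v].
have -> : core (~~ b) :&: [set v in core b | Z v] = set0.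
  apply/setP => v; rewrite !inE; apply/negP => /and3P[v1 v2 _].
  by have := core_disj v2; rewrite v1.
rewrite cards0 addn0 => <-; apply/subset_leq_card/subsetP => v.
by rewrite !inE => /orP[/hZ|/andP[]].
Qed.

(** Each vertex of core b sends many arcs to vertices that cannot be entered from core b, while each
    of those receives fewer than [tau] from it, so [match_list] applies. The abilities excluded for
    p.2 make it cheap to reserve; few core vertices have them because the pools concerned are
    small. *)
Lemma augment_in b (Z S : {set T}) N (hg : bool) :
  pool b < n + k -> hg || (pool (~~ b) < n + 3 * k + 2 * G) ->
  N <= k + 2 * G -> #|Z| <= 4 * k -> #|S| <= k ->
  0 < d.+1 - #|[set v | cin b v]| -> N <= 2 * (d.+1 - #|[set v | cin b v]|) ->
  exists prs : seq (T * T), [/\ size prs = N, uniq (unzip1 prs), uniq (unzip2 prs) &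
    {in prs, forall p, [/\ p.1 \notin Z, p.2 \notin Z, p.2 \notin S &
      [&& ~~ cin b p.1, p.2 \in core b, e p.2 p.1, ~~ cout (~~ b) p.2 &
          hg || ~~ cin (~~ b) p.2]]}].
Proof.
move=> hb hnb hN hZ hS; set beta := _ - _ => b0 Nb.
pose Lf := [set x in core b | [&& x \notin Z, x \notin S, ~~ cout (~~ b) x & hg || ~~ cin (~~ b) x]].
pose Rt := [set y | ~~ cin b y].
have cLf : #|core b| <= #|Lf| + (#|Z| + #|S| + (k + 2 * G) + (3 * k + 4 * G)).
  pose A := [set x in core b | cout (~~ b) x].
  pose B := [set x in core b | ~~ hg && cin (~~ b) x].
  have cA : #|A| <= k + 2 * G.
    have h : #|core (~~ b)| + #|A| <= #|[set v | cout (~~ b) v]| := card_cap (@core_out (~~ b)).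
    have : #|core b| <= #|[set v | cin b v]|.
      by apply/subset_leq_card/subsetP => v /core_in; rewrite inE.
    by have := card_cores b; move: hb h; rewrite /pool; move: #|A|; clear; lia.
  have cB : #|B| <= 3 * k + 4 * G.
    rewrite /B; case: (hg) hnb => /= h.
      by rewrite (_ : [set _ in _ | _] = set0) ?cards0 //; apply/setP => v; rewrite !inE andbF.
    have h1 : #|core (~~ b)| + #|[set v in core b | cin (~~ b) v]| <= #|[set v | cin (~~ b) v]|.
      exact: card_cap (@core_in (~~ b)).
    have : #|core b| <= #|[set v | cout b v]|.
      by apply/subset_leq_card/subsetP => v /core_out; rewrite inE.
    by have := card_cores b; move: h h1; rewrite /pool negbK; clear; lia.
  have : core b \subset Lf :|: (Z :|: (S :|: (A :|: B))).
    apply/subsetP => x xb; rewrite !inE xb /=.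
    by case: (x \in Z); case: (x \in S); case: (cout _ x); case: (hg); case: (cin _ x).
  move/subset_leq_card => h; apply: leq_trans h _.
  apply: leq_trans (leq_card_setU _ _).1 _; rewrite leq_add2l -!addnA.
  apply: leq_trans (leq_card_setU _ _).1 _; rewrite leq_add2l.
  apply: leq_trans (leq_card_setU _ _).1 _; rewrite leq_add2l.
  apply: leq_trans (leq_card_setU _ _).1 _.
  by move: cA cB; clear; lia.
have [|||prs [sp U1 U2 hp]] := @match_list T e Lf Rt Z beta tau N.
- move=> x; rewrite inE => /and5P[xb _ _ _ _].
  have xc : x \in [set v | cin b v] by rewrite inE core_in.
  (* x belongs to the set of enterable vertices but is not its own out-neighbour, which gives the
     successor of d in [beta]. *)
  have sub : [set w in setT | e x w] \subset [set y in Rt | e x y] :|: ([set v | cin b v] :\ x).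
    apply/subsetP => w; rewrite !inE /= => exw; rewrite exw andbT.
    by case: (cin b w); rewrite ?orbT //= andbT; apply: contraTneq exw => ->; rewrite irr.
  have := leq_trans (subset_leq_card sub) (leq_card_setU _ _).1.
  have := degO x; rewrite /dout /beta; rewrite (cardsD1 x [set v | cin b v]) xc.
  by move: #|_ :\ _| #|[set w in setT | _]| #|[set y in Rt | _]|; clear; lia.
- move=> y; rewrite inE /capin -ltnNge => hy; apply: leq_trans (ltnW hy).
  by apply/subset_leq_card/subsetP => x; rewrite !inE => /andP[/andP[-> _] ->].
- have hl : (4 * k + 2) * tau < #|Lf| - N.
    have := core_big b; move: cLf hN hZ hS large kG; clear.
    by move=> cLf hN hZ hS; lia.
  (* N <= 2 beta, |Z| <= 4k and beta > 0 give (N + |Z|) tau <= (4k + 2) tau beta; this is the origin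
     of the first term in [large]. *)
  apply: leq_ltn_trans (_ : (4 * k + 2) * tau * beta < _); last by rewrite ltn_pmul2r.
  rewrite mulnAC leq_mul2r; apply/orP; right; move: b0 Nb hZ; clear; nia.
exists prs; split=> // p /hp/and4P[h1 h2 h3 h4].
move: h1 h3; rewrite !inE => -> /and5P[-> -> -> -> ->].
by rewrite h2 h4.
Qed.

End AugmentIn.

Section Augment.
Variables (T : finType) (e : rel T) (core : bool -> {set T}) (G tau d k n : nat).
Variable S : {set T}.
Hypothesis irr : irreflexive e.
Hypothesis degO : forall v, d <= dout e setT v.
Hypothesis degI : forall v, d <= din e setT v.
Hypothesis dk : n + k <= d.*2.+2.
Hypothesis cardT : #|T| = n.
Hypothesis core_disj : forall b v, v \in core b -> v \notin core (~~ b).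
Hypothesis core_big : forall b, n <= 2 * (#|core b| + G).
Hypothesis core_in : forall b v, v \in core b -> capin e core tau b v.
Hypothesis core_out : forall b v, v \in core b -> capout e core tau b v.
Hypothesis kG : k <= G.
Hypothesis large : (4 * k + 2) * tau + 40 * G < n./2.
Hypothesis Sk : #|S| <= k.

Notation cin := (capin e core tau).
Notation cout := (capout e core tau).
Notation tot := (pool e core tau).

(** Setting a private vertex aside loses at most 2 units and lowers the demand by 1. As there are at
    most 2k + 2G of them ([card_privates]), a pool of this size still leaves n + k. *)
Definition huge b := n + 3 * k + 2 * G <= tot b.

(* When the pool for direction b (leave side ~~ b, or enter side b) is too
   small, prs lists vertices p.1 outside the pool with a private neighbour p.2;
   tag tells whether p.2 serves as an in- or an out-neighbour. *)
Definition helper (tag b : bool) (p : T * T) :=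
  if tag then [&& ~~ cin b p.1, p.2 \in core b, e p.2 p.1, ~~ cout (~~ b) p.2 &
    huge (~~ b) || ~~ cin (~~ b) p.2]
  else [&& ~~ cout (~~ b) p.1, p.2 \in core (~~ b), e p.1 p.2, ~~ cin b p.2 &
    huge (~~ b) || ~~ cout b p.2].

Lemma tot_ge b : n <= tot b + 2 * G.
Proof.
have : #|core (~~ b)| <= #|[set v | cout (~~ b) v]|.
  by apply/subset_leq_card/subsetP => v /core_out; rewrite inE.
have : #|core b| <= #|[set v | cin b v]|.
  by apply/subset_leq_card/subsetP => v /core_in; rewrite inE.
by have := card_cores core_big b; rewrite /pool; clear; lia.
Qed.

(** This is where the exact degree bound enters: n + k <= 2d + 2 bounds the deficit by the sum of d
    + 1 - #{enterable from b} and d + 1 - #{leavable to ~~b}. The larger term is at least half the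
    deficit and decides the tag; the out-version is [augment_in] for the reversed digraph. *)
Lemma augment_dir b (Z : {set T}) : (tot b < n + k -> #|Z| <= 4 * k) ->
  exists (tag : bool) (prs : seq (T * T)), [/\ size prs = n + k - tot b,
    uniq (unzip1 prs), uniq (unzip2 prs) &
    {in prs, forall p, [/\ p.1 \notin Z, p.2 \notin Z, p.2 \notin S & helper tag b p]}].
Proof.
have [le|lt] := leqP (n + k) (tot b).
  by move=> _; exists true, [::]; split=> //=; apply/esym/eqP; rewrite subn_eq0.
move=> /(_ isT) hZ.
have hN : n + k - tot b <= k + 2 * G by have := tot_ge b; clear; lia.
have hflag : huge (~~ b) || (tot (~~ b) < n + 3 * k + 2 * G) by rewrite /huge ltnNge orbN.
have : n + k - tot b <= (d.+1 - #|[set v | cin b v]|) + (d.+1 - #|[set v | cout (~~ b) v]|).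
  by move: dk; rewrite /pool; clear; lia.
have [hle|hlt] := leqP (d.+1 - #|[set v | cout (~~ b) v]|) (d.+1 - #|[set v | cin b v]|) => hsum.
  have [||prs [sp U1 U2 hp]] := augment_in irr degO core_disj core_big core_in core_out
    kG large lt hflag hN hZ Sk.
  - by move: lt hle hsum; clear; lia.
  - by move: lt hle hsum; clear; lia.
  by exists true, prs.
have lt' : pool (fun x y => e y x) core tau (~~ b) < n + k.
  by rewrite /pool negbK addnC.
have hflag' : huge (~~ b) || (pool (fun x y => e y x) core tau (~~ ~~ b) < n + 3 * k + 2 * G).
  by move: hflag; rewrite /pool !negbK addnC.
have irr' : irreflexive (fun x y => e y x) by move=> x; apply: irr.
have [||prs [sp U1 U2 hp]] := augment_in (e := fun x y => e y x) irr' degI core_disj core_big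
    core_out core_in kG large lt' hflag' hN hZ Sk.
- by move: lt hlt hsum; rewrite /capin /capout; clear; lia.
- by move: lt hlt hsum; rewrite /capin /capout; clear; lia.
exists false, prs; split=> // p /hp; rewrite !negbK => -[h1 h2 h3 h4]; split=> //.
Qed.

Hypothesis capI : forall v, cin true v || cin false v.
Hypothesis capO : forall v, cout true v || cout false v.

Lemma card_sum (Z : pred T) : #|[set v | Z v]| = \sum_v Z v.
Proof.
by rewrite -sum1_card big_mkcond; apply: eq_bigr => v _; rewrite inE; case: (Z v).
Qed.

Lemma tot_sum : 2 * n <= tot true + tot false.
Proof.
rewrite /pool /= !card_sum -!big_split /= -cardT -sum1_card big_distrr /=.
apply: leq_sum => v _; move: (capI v) (capO v).
by case: (cin true v); case: (cin false v); case: (cout true v); case: (cout false v).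
Qed.

Lemma helper_neq tag b p p' : helper tag b p -> helper tag b p' -> p.1 != p'.2.
Proof.
rewrite /helper; case: tag => /and5P[h1 _ _ _ _] /and5P[_ h2 _ _ _]; apply: contraNneq h1 => ->.
  exact: core_in.
exact: core_out.
Qed.

Lemma helpers_exist : exists (tag : bool -> bool) (prs : bool -> seq (T * T)),
  [/\ forall b, [/\ uniq (unzip1 (prs b)), uniq (unzip2 (prs b)) & size (prs b) = n + k - tot b],
    forall b, {in prs b, forall p, helper (tag b) b p && (p.2 \notin S)},
    forall b b' p p', p \in prs b -> p' \in prs b' -> p.1 != p'.2 &
    forall b p p', p \in prs b -> p' \in prs (~~ b) -> p.2 != p'.2].
Proof.
have [_|t1 [p1 [s1 u1 v1 h1]]] := @augment_dir true set0; first by rewrite cards0.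
pose Z := [set y in unzip1 p1] :|: [set x in unzip2 p1].
have cZ : #|Z| <= 2 * (n + k - tot true).
  have c (w : seq T) : #|[set y in w]| <= size w by rewrite cardsE card_size.
  have := (leq_card_setU [set y in unzip1 p1] [set x in unzip2 p1]).1.
  have := c (unzip1 p1); have := c (unzip2 p1); rewrite !size_map s1 -/Z.
  by clear; lia.
have [hb|t2 [p2 [s2 u2 v2 h2]]] := @augment_dir false Z.
  (* If the second pool is below n + k, the first exceeds n - k, so fewer than 2k pairs have been
     taken. *)
  by move: cZ tot_sum hb; move: #|Z|; clear; lia.
have in1 p : p \in p1 -> (p.1 \in Z) && (p.2 \in Z).
  move=> pp; rewrite !inE; apply/andP; split; apply/orP; [left|right]; exact: map_f.
exists (fun b => if b then t1 else t2), (fun b => if b then p1 else p2); split.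
- by case; split.
- by case=> p; [case/h1 | case/h2] => _ _ -> ->.
- case; case=> p p' hp hp'.
  + by have [_ _ _ g] := h1 p hp; have [_ _ _ g'] := h1 p' hp'; apply: helper_neq g g'.
  + have [_ g _ _] := h2 p' hp'; have /andP[g' _] := in1 p hp.
    by apply: contraNneq g => <-.
  + have [g _ _ _] := h2 p hp; have /andP[_ g'] := in1 p' hp'.
    by apply: contraNneq g => ->.
  by have [_ _ _ g] := h2 p hp; have [_ _ _ g'] := h2 p' hp'; apply: helper_neq g g'.
case=> p p' /= hp hp'.
  have [_ g _ _] := h2 p' hp'; have /andP[_ g'] := in1 p hp.
  by apply: contraNneq g => <-.
have [_ g _ _] := h2 p hp; have /andP[_ g'] := in1 p' hp'.
by apply: contraNneq g => ->.
Qed.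

(** * Attaching the private neighbours *)

Section Interface.
Variables (tag : bool -> bool) (prs : bool -> seq (T * T)).
Hypothesis prs_uniq1 : forall b, uniq (unzip1 (prs b)).
Hypothesis prs_uniq2 : forall b, uniq (unzip2 (prs b)).
Hypothesis prs_size : forall b, size (prs b) = n + k - tot b.
Hypothesis prs_helper : forall b, {in prs b, forall p, helper (tag b) b p && (p.2 \notin S)}.
Hypothesis prs12 : forall b b' p p', p \in prs b -> p' \in prs b' -> p.1 != p'.2.
Hypothesis prs22 : forall b p p', p \in prs b -> p' \in prs (~~ b) -> p.2 != p'.2.

(* The abilities of a vertex once its private neighbour, if any, is attached. *)
Definition enter b v := cin b v || (tag b && (v \in unzip1 (prs b))).
Definition leave b v := cout b v || (~~ tag (~~ b) && (v \in unzip1 (prs (~~ b)))).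
Definition look b v := [seq p.2 | p <- prs b & p.1 == v].
Definition pre b v := if cin b v then [::] else if tag b then look b v else [::].
Definition post b v := if cout b v then [::] else if tag (~~ b) then [::] else look (~~ b) v.
Definition privates : {set T} := [set x | (x \in unzip2 (prs true)) || (x \in unzip2 (prs false))].

(** A private neighbour travels with its owner only in triples that use the borrowed ability. *)
Definition bead (t : bool * T * bool) := pre t.1.1 t.1.2 ++ t.1.2 :: post t.2 t.1.2.

Lemma mem_look b v x : x \in look b v -> (v, x) \in prs b.
Proof.
by case/mapP => -[y z]; rewrite mem_filter /= => /andP[/eqP-> h] ->.
Qed.

Lemma look_one b v : v \in unzip1 (prs b) -> exists x, look b v = [:: x] /\ (v, x) \in prs b.
Proof.
have := prs_uniq1 b; rewrite /look; elim: (prs b) => //= -[y z] l IH /= /andP[yl Ul].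
rewrite inE eq_sym => /orP[/eqP E|vl].
  subst y; rewrite eqxx /=; exists z; rewrite mem_head; split=> //.
  rewrite (eq_in_filter (a2 := pred0)) ?filter_pred0 // => -[y' z'] h /=.
  by apply: contraNF yl => /eqP<-; apply/mapP; exists (y', z').
have [E|_] := eqVneq y v; first by rewrite -E (negPf yl) in vl.
by have [x [-> h]] := IH Ul vl; exists x; rewrite inE h orbT.
Qed.

Lemma privateP b p : p \in prs b -> p.2 \in privates.
Proof.
by move=> h; rewrite inE; case: b h => h; rewrite (map_f snd h) ?orbT.
Qed.

Lemma bead_good t : valid enter leave t ->
  goodpiece e core tau (t.1.1, bead t, t.2).
Proof.
case: t => -[b v] b' /andP[/= hI hO]; rewrite /bead /goodpiece /=.
have postP : exists r, [/\ post b' v = r, path e v r & cout b' (last v r)].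
  rewrite /post; move: hO; rewrite /leave; case: (boolP (cout b' v)) => [c _|_ /=]; first by exists [::].
  case/andP => nt vp; rewrite (negPf nt); have [x [-> vx]] := look_one vp.
  exists [:: x]; split=> //; have /andP[] := prs_helper vx; rewrite /helper (negPf nt) negbK /=.
    by case/and5P => _ _ ->.
  by case/and5P => _ /core_out.
have [r [-> pr cr]] := postP; rewrite /pre; move: hI; rewrite /enter.
case: (boolP (cin b v)) => [c _|_ /= /andP[tb vp]]; first by rewrite /= pr c cr.
rewrite tb; have [x [-> vx]] := look_one vp; rewrite /= pr cr.
have /andP[] := prs_helper vx; rewrite /helper tb /= => /and5P[_ /core_in-> -> _ _] _.
by [].
Qed.

Lemma pre_private b v x : x \in pre b v -> (v, x) \in prs b /\ tag b.
Proof. by rewrite /pre; case: (cin b v) => //; case: (tag b) => // /mem_look. Qed.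

Lemma post_private b v x : x \in post b v -> (v, x) \in prs (~~ b) /\ ~~ tag (~~ b).
Proof. by rewrite /post; case: (cout b v) => //; case: (tag (~~ b)) => // /mem_look. Qed.

Lemma owner b b' v w x : (v, x) \in prs b -> (w, x) \in prs b' -> v = w /\ b = b'.
Proof.
move=> vx wx; have [E|nb] := eqVneq b b'.
  subst b'; split=> //; have := prs_uniq2 b.
  elim: (prs b) vx wx => //= -[y z] l IH; rewrite !inE => h1 h2 /= /andP[zl Ul].
  case/orP: h1 => [/eqP[Ev Ex]|h1]; case/orP: h2 => [/eqP[Ew Ez]|h2].
  - by rewrite Ev Ew.
  - by case/negP: zl; apply/mapP; exists (w, x).
  - by case/negP: zl; apply/mapP; exists (v, x).
  exact: IH.
have Eb : b' = ~~ b by move: nb; case: (b); case: (b').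
by subst b'; have := prs22 vx wx; rewrite eqxx.
Qed.

Lemma bead_mem t x : x \in bead t -> x = t.1.2 \/
  exists2 b, (t.1.2, x) \in prs b & (x \in pre t.1.1 t.1.2) || (x \in post t.2 t.1.2).
Proof.
rewrite mem_cat inE => /or3P[h|/eqP->|h]; [right|by left|right].
  by have [h1 _] := pre_private h; exists t.1.1; rewrite // h.
by have [h1 _] := post_private h; exists (~~ t.2); rewrite // h orbT.
Qed.

Lemma beads_uniq tl : uniq (verts tl) -> {in verts tl, forall v, v \notin privates} ->
  uniq (flatten [seq bead t | t <- tl]).
Proof.
elim: tl => //= t tl IH /andP[tn Ut] np.
have np' : {in verts tl, forall v, v \notin privates} by move=> v vt; apply: np; rewrite inE vt orbT.
have nt : t.1.2 \notin privates by apply: np; rewrite mem_head.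
have priv v x b : (v, x) \in prs b -> x \in privates := @privateP b (v, x).
have look_uniq b v : uniq (look b v).
  by rewrite /look; have := prs_uniq2 b; apply: subseq_uniq; apply: map_subseq; apply: filter_subseq.
rewrite cat_uniq IH // andbT; apply/andP; split.
  rewrite /bead cat_uniq /=; apply/and4P; split.
  - by rewrite /pre; case: ifP => // _; case: ifP.
  - rewrite negb_or; apply/andP; split.
      by apply: contra nt => /pre_private[/priv].
    apply/hasPn => x /post_private[x1 t1]; apply/negP => /pre_private[x2 t2].
    by have [_ E] := owner x1 x2; move: t1; rewrite E t2.
  - by apply: contra nt => /post_private[/priv].
  by rewrite /post; case: ifP => // _; case: ifP.
apply/hasPn => x /flattenP[q /mapP[u utl ->] xu]; apply/negP => xt.
have utv : u.1.2 \in verts tl by apply: map_f.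
have ut : u.1.2 != t.1.2 by apply: contraNneq tn => <-.
case: (bead_mem xu) => [E|[b x1 _]]; case: (bead_mem xt) => [E'|[b' x2 _]].
- by move: ut; rewrite -E -E' eqxx.
- by have := np' _ utv; rewrite -E (priv _ _ _ x2).
- by move: nt; rewrite -E' (priv _ _ _ x1).
by have [E _] := owner x1 x2; move: ut; rewrite E eqxx.
Qed.

Lemma size_bead t : size (bead t) <= 3.
Proof.
have look1 b v : size (look b v) <= 1.
  have [h|h] := boolP (v \in unzip1 (prs b)); first by have [x [-> _]] := look_one h.
  rewrite /look (eq_in_filter (a2 := pred0)) ?filter_pred0 // => -[y z] yz /=.
  by apply: contraNF h => /eqP<-; apply/mapP; exists (y, z).
have h1 : size (pre t.1.1 t.1.2) <= 1 by rewrite /pre; case: ifP => // _; case: ifP.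
have h2 : size (post t.2 t.1.2) <= 1 by rewrite /post; case: ifP => // _; case: ifP.
by rewrite /bead size_cat /=; move: h1 h2; clear; lia.
Qed.

Lemma privates_S v : v \in privates -> v \notin S.
Proof.
by rewrite inE => /orP[] /mapP[p /prs_helper/andP[_ h] ->].
Qed.

Lemma privates_core v : v \in privates -> exists b, v \in core b.
Proof.
rewrite inE => /orP[] /mapP[p /prs_helper/andP[]]; rewrite /helper.
  by case: (tag true) => /and5P[_ h _ _ _] _ ->; eexists; exact: h.
by case: (tag false) => /and5P[_ h _ _ _] _ ->; eexists; exact: h.
Qed.

Lemma card_privates : #|privates| <= 2 * k + 2 * G.
Proof.
have : #|privates| <= size (prs true) + size (prs false).
  have -> : privates = [set x in unzip2 (prs true)] :|: [set x in unzip2 (prs false)].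
    by apply/setP => x; rewrite !inE.
  apply: leq_trans (leq_card_setU _ _).1 _; rewrite !cardsE.
  by rewrite leq_add // (leq_trans (card_size _)) // size_map.
by rewrite !prs_size; move: tot_sum (tot_ge true) (tot_ge false); clear; lia.
Qed.

(** Every helped vertex of direction b gains exactly the one unit it lacked, and [prs_size] makes up
    the deficit of the pool. *)
Lemma flux_total b : n + k <= \sum_v (leave (~~ b) v + enter b v : nat).
Proof.
have h : tot b + #|[set y in unzip1 (prs b)]| <= \sum_v (leave (~~ b) v + enter b v : nat).
  rewrite /pool !card_sum -!big_split /=; apply: leq_sum => v _.
  rewrite /leave /enter negbK; case hv: (v \in unzip1 (prs b)); last first.
    by rewrite !andbF !orbF addn0.
  rewrite !andbT; case/mapP: hv => p /prs_helper/andP[]; rewrite /helper => + _ ->.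
  case: (tag b) => /and5P[/negPf-> _ _ _ _] /=; rewrite ?orbT ?orbF.
    by case: (cout (~~ b) p.1).
  by case: (cin b p.1).
by move: h; rewrite cardsE (card_uniqP (prs_uniq1 b)) size_map prs_size; clear; lia.
Qed.

Lemma enter_private x b : x \in privates -> enter b x = cin b x.
Proof.
move=> xp; rewrite /enter [_ \in _](_ : _ = false) ?andbF ?orbF //.
apply/negP => /mapP[p hp E]; move: xp; rewrite inE => /orP[]/mapP[q hq E2].
  by have := prs12 hp hq; rewrite -E -E2 eqxx.
by have := prs12 hp hq; rewrite -E -E2 eqxx.
Qed.

Lemma leave_private x b : x \in privates -> leave b x = cout b x.
Proof.
move=> xp; rewrite /leave [_ \in _](_ : _ = false) ?andbF ?orbF //.
apply/negP => /mapP[p hp E]; move: xp; rewrite inE => /orP[]/mapP[q hq E2].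
  by have := prs12 hp hq; rewrite -E -E2 eqxx.
by have := prs12 hp hq; rewrite -E -E2 eqxx.
Qed.

(** For a private vertex of direction b this is the fourth clause of [helper], for one of the
    opposite direction the fifth. *)
Lemma private_flux b x : x \in privates -> ~~ huge b -> leave (~~ b) x + enter b x <= 1.
Proof.
move=> xp nh; rewrite leave_private // enter_private //.
have [c xc] : exists c, x \in unzip2 (prs c).
  by move: xp; rewrite inE => /orP[h|h]; [exists true | exists false].
case/mapP: xc => p /prs_helper/andP[hp _] E; move: hp; rewrite /helper -!E.
have [Ec|nc] := eqVneq c b.
  by subst c; case: (tag b) => /and5P[_ _ _ /negPf-> _]; case: (_ (_ : T)).
have Ec : c = ~~ b by move: nc; case: (c); case: (b).
subst c; rewrite negbK (negPf nh) /=.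
by case: (tag (~~ b)) => /and5P[_ _ _ _ /negPf->]; case: (_ (_ : T)).
Qed.

(** A private vertex takes away one unit if [huge b] fails, which matches its share |privates| of
    the demand; otherwise it may take two, and the surplus in [huge] covers this. *)
Lemma flux_rest b : n + k <= \sum_(v | v \notin privates) (leave (~~ b) v + enter b v) + #|privates|.
Proof.
have tl := flux_total b; rewrite (bigID [in privates]) /= in tl.
have [hh|nh] := boolP (huge b); last first.
  have : \sum_(v in privates) (leave (~~ b) v + enter b v) <= #|privates|.
    by rewrite -sum1_card; apply: leq_sum => v vp; apply: private_flux.
  by move: tl; clear; lia.
have h2 : tot b <= \sum_v (leave (~~ b) v + enter b v : nat).
  rewrite /pool !card_sum -!big_split /=; apply: leq_sum => v _.
  by rewrite /leave /enter; apply: leq_add; case: (cout _ _); case: (cin _ _).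
rewrite (bigID [in privates]) /= in h2.
have : \sum_(v in privates) (leave (~~ b) v + enter b v) <= 2 * #|privates|.
  rewrite -sum1_card big_distrr /=; apply: leq_sum => v _.
  by case: (leave _ _); case: (enter _ _).
by move: h2 hh card_privates; rewrite /huge; clear; lia.
Qed.

End Interface.

End Augment.

Section Stays.
Variables (T : finType) (I O : bool -> pred T).
Implicit Types (tl : seq (bool * T * bool)) (b : bool) (vs : seq T).

Definition stays b vs : seq (bool * T * bool) := [seq (b, v, b) | v <- vs].

Lemma insert_stays b c d tl vs : tchain d tl c -> sides b tl -> all (valid I O) tl ->
  {in vs, forall v, I b v && O b v} ->
  exists tl', [/\ tchain d tl' c, perm_eq tl' (tl ++ stays b vs), subseq (verts tl) (verts tl'),
    all (valid I O) tl' & perm_eq (verts tl') (verts tl ++ vs)].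
Proof.
move=> tc sb va vsok.
have lc : tchain b (stays b vs) b by elim: (vs) => //= v l ->; rewrite eqxx.
have [tl' [h1 h2 h3]] := tchain_insert tc lc sb; exists tl'; split=> //.
- exact: map_subseq.
- rewrite (perm_all _ h2) all_cat va /=; apply/allP => t /mapP[v /vsok h ->].
  exact: h.
rewrite (perm_trans (perm_map _ h2)) // map_cat perm_cat2l /stays -map_comp.
by rewrite (eq_map (g := id)) ?map_id.
Qed.

End Stays.

Lemma tchain_map (T : eqType) (f : bool * T * bool -> seq T) b c tl :
  tchain b tl c -> tchain b [seq (t.1.1, f t, t.2) | t <- tl] c.
Proof. by elim: tl b => //= t tl IH b /andP[-> /IH->]. Qed.

(** * Hamilton cycles through two near-cliques *)

Section CliquePair.
Variables (T : finType) (e : rel T) (core : bool -> {set T}) (G d k n : nat).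
Hypothesis cardT : #|T| = n.
Hypothesis irr : irreflexive e.
Hypothesis degO : forall v, d <= dout e setT v.
Hypothesis degI : forall v, d <= din e setT v.
Hypothesis dk : n + k <= d.*2.+2.
Hypothesis core_disj : forall b v, v \in core b -> v \notin core (~~ b).
Hypothesis core_big : forall b, n <= 2 * (#|core b| + G).
Hypothesis core_nonout : forall b v, v \in core b -> #|[set w in core b | ~~ e v w]| <= G.
Hypothesis core_nonin : forall b v, v \in core b -> #|[set w in core b | ~~ e w v]| <= G.
Hypothesis k3 : 2 < k.
Hypothesis kG : k <= G.
Hypothesis large : 2000 * k * G <= n.

(** The final chain has at most 22G beads, with at most 3 vertices and 3 joining vertices each, so
    [complete_pieces] asks for 134G + 3 <= tau. Conversely n >= 4000G leaves every vertex tau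
    neighbours in some core, for arcs of either orientation. *)
Let tau := 200 * G.
Let E := [set v | (v \notin core true) && (v \notin core false)].

Let cE : #|E| <= 2 * G.
Proof.
have := cardsUI (core true) (core false).
have -> : core true :&: core false = set0.
  by apply/setP => v; rewrite !inE; apply/negP => /andP[/core_disj/negPf->].
have : #|E| = #|~: (core true :|: core false)| by apply: eq_card => v; rewrite !inE negb_or.
have := cardsC (core true :|: core false); rewrite cardT cards0.
by move: (core_big true) (core_big false); clear; lia.
Qed.

Let big : 4000 * G <= n.
Proof. by apply: leq_trans large; rewrite leq_mul2r; apply/orP; right; move: k3; clear; lia. Qed.

Lemma core_cin b v : v \in core b -> capin e core tau b v.
Proof.
move=> /core_nonin; rewrite /capin; have := cardsID [set w | e w v] (core b).
have -> : core b :&: [set w | e w v] = [set w in core b | e w v] by apply/setP => w; rewrite !inE.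
have -> : core b :\: [set w | e w v] = [set w in core b | ~~ e w v].
  by apply/setP => w; rewrite !inE andbC.
by move: big (core_big b); rewrite /tau;clear; lia.
Qed.

Lemma core_cout b v : v \in core b -> capout e core tau b v.
Proof.
move=> /core_nonout; rewrite /capout; have := cardsID [set w | e v w] (core b).
have -> : core b :&: [set w | e v w] = [set w in core b | e v w] by apply/setP => w; rewrite !inE.
have -> : core b :\: [set w | e v w] = [set w in core b | ~~ e v w].
  by apply/setP => w; rewrite !inE andbC.
by move: big (core_big b); rewrite /tau;clear; lia.
Qed.

Let split_deg (Z : pred T) : d <= #|[set w in setT | Z w]| ->
  (tau <= #|[set w in core true | Z w]|) || (tau <= #|[set w in core false | Z w]|).
Proof.
move=> h; have : [set w in setT | Z w] \subset
    E :|: ([set w in core true | Z w] :|: [set w in core false | Z w]).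
  apply/subsetP => w; rewrite !inE /= => ->; rewrite !andbT.
  by case: (w \in core true); case: (w \in core false).
move/subset_leq_card => h1.
have h2 := (leq_card_setU E ([set w in core true | Z w] :|: [set w in core false | Z w])).1.
have h3 := (leq_card_setU [set w in core true | Z w] [set w in core false | Z w]).1.
rewrite -implyNb; apply/implyP; rewrite -ltnNge => h4.
move: h h1 h2 h3 h4 cE big dk; rewrite /tau; clear; lia.
Qed.

Lemma cap_in v : capin e core tau true v || capin e core tau false v.
Proof. exact: split_deg (degI v). Qed.

Lemma cap_out v : capout e core tau true v || capout e core tau false v.
Proof. exact: split_deg (degO v). Qed.

Theorem clique_pair_ordered : k_ordered_hamiltonian e k.
Proof.
move=> s sk Us.
have Sk : #|[set v in s]| <= k by rewrite cardsE (card_uniqP Us) sk.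
have large' : (4 * k + 2) * tau + 40 * G < n./2.
  have : (4 * k + 2) * tau + 40 * G < 1000 * k * G.
    by rewrite /tau; move: k3 kG; clear; nia.
  by move: large; clear; lia.
have [tag [prs [h1 h2 p12 p22]]] := helpers_exist irr degO degI dk cardT core_disj core_big
  core_cin core_cout kG large' Sk cap_in cap_out.
have u1 b : uniq (unzip1 (prs b)) by case: (h1 b).
have u2 b : uniq (unzip2 (prs b)) by case: (h1 b).
have sp b : size (prs b) = n + k - pool e core tau b by case: (h1 b).
pose I := enter e core tau tag prs; pose O := leave e core tau tag prs.
pose R := privates prs; pose bd := bead e core tau tag prs.
have Rs v : v \in R -> v \notin s.
  by move=> /(privates_S h2); rewrite inE.
have Rcore v : v \in R -> exists b, v \in core b by move=> vR; exact: (privates_core h2 vR).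
have cR : #|R| <= 2 * k + 2 * G := card_privates cardT core_big core_cin core_cout cap_in cap_out sp.
have capI v : I true v || I false v by rewrite /I /enter; case/orP: (cap_in v) => ->; rewrite ?orbT.
have capO v : O true v || O false v by rewrite /O /leave; case/orP: (cap_out v) => ->; rewrite ?orbT.
pose U := [set v | (v \notin R) && (v \notin s)].
have sU : {in s, forall v, v \notin U} by move=> v vs; rewrite inE vs andbF.
have enough b : #|U| + (size s).*2 <= \sum_(v in U) flux I O b v + \sum_(v <- s) flux I O b v.
  have h : n + k <= \sum_(v | v \notin R) (O (~~ b) v + I b v) + #|R|.
    have h0 := flux_rest cardT core_big core_cin core_cout cap_in cap_out u1 sp h2 p12 b.
    exact: h0.
  rewrite (bigID [in s]) /= in h.
  have EU : \sum_(v in U) flux I O b v =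
      \sum_(v | (v \notin R) && (v \notin s)) (O (~~ b) v + I b v).
    by apply: eq_bigl => v; rewrite inE.
  have Es : \sum_(v <- s) flux I O b v = \sum_(v | (v \notin R) && (v \in s)) (O (~~ b) v + I b v).
    rewrite big_uniq //; apply: eq_bigl => v.
    by case vs: (v \in s); rewrite ?andbF // andbT; apply/esym; apply: contraTN vs => /Rs.
  have cU : #|U| + (#|R| + k) = n.
    have -> : U = ~: (R :|: [set v in s]).
      by apply/setP => v; rewrite in_setC in_setU negb_or [v \in U]inE [v \in [set w in s]]inE.
    have -> : #|R| + k = #|R :|: [set v in s]|.
      have := cardsUI R [set v in s]; rewrite [#|[set v in s]|]cardsE (card_uniqP Us) sk => <-.
      have -> : R :&: [set v in s] = set0.
        apply/setP => v; rewrite [LHS]inE [v \in [set v in s]]inE in_set0.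
        by apply/negP => /andP[/Rs/negPf->].
      by rewrite cards0 addn0.
    by rewrite addnC cardsC.
  rewrite EU Es sk; move: h cU.
  move: (\sum_(v | (v \notin R) && (v \in s)) _) (\sum_(v | (v \notin R) && (v \notin s)) _) #|U| #|R|.
  by clear; lia.
have s3 : 2 < size s by rewrite sk.
have core_str b v : v \in core b -> I b v && O b v.
  by move=> vb; rewrite /I /O /enter /leave core_cin // core_cout.
have rigE b v : v \in rigid I O U b -> v \in E.
  rewrite inE => /and3P[_ h3 h4].
  suff nc c : v \notin core c by rewrite inE !nc.
  apply/negP => /core_str/andP[h5 h6].
  have [Ec|ne] := eqVneq c b; first by rewrite -Ec h6 in h4.
  have Ec : c = ~~ b by move: ne; case: (c); case: (b).
  by rewrite -Ec h5 in h3.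
have crig b : #|rigid I O U b| <= 2 * G.
  by apply: leq_trans cE; apply/subset_leq_card/subsetP => v /rigE.
have [tl [[b0 tc] [Uv sv vv] sides_tl verts_in verts_str] size_tl] :=
  arrange_exists Us sU s3 capI capO enough.
have stl : size (verts tl) <= 13 * G.
  by move: size_tl (crig true) (crig false); rewrite size_map sk; move: kG k3; clear; lia.
pose W := [set v in verts tl].
have cW : #|W| <= 13 * G by rewrite cardsE (leq_trans (card_size _)).
(* Exceptional vertices that the arrangement did not use; they are straight, so they can be visited
   from within a single core. *)
pose strE b := [set v in E | (v \notin W) && (I b v && O b v)].
(* Core vertices visited on purpose: each yields a junction in its core, and 2G + 1 of them supply
   the slots that [complete_pieces] requires. *)
have dummies b : exists D : {set T}, [/\ D \subset core b :\: W :\: R & #|D| = 2 * G + 1].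
  have [||D [_ h3 h4]] := @subset_of_card T set0 (core b :\: W :\: R) (2 * G + 1).
  - exact: sub0set.
  - rewrite cards0 /=; have := card_setD_ge (core b) W; have := card_setD_ge (core b :\: W) R.
    by move: (core_big b) big cR cW kG k3; clear; lia.
  by exists D.
have [D1 [D1s D1c]] := dummies true; have [D2 [D2s D2c]] := dummies false.
pose X1 := D1 :|: strE true; pose X2 := D2 :|: (strE false :\: strE true).
have in_D b (D : {set T}) v : D \subset core b :\: W :\: R -> v \in D ->
    [/\ v \in core b, v \notin verts tl & v \notin R].
  move=> /subsetP h /h; rewrite in_setD => /andP[vR]; rewrite in_setD => /andP[vW vc].
  by split=> //; move: vW; rewrite inE.
have in_E v : v \in E -> forall b, v \notin core b by rewrite inE => /andP[h3 h4] [].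
have in_str b v : v \in strE b -> [/\ v \in E, v \notin verts tl, v \notin R & I b v && O b v].
  rewrite [v \in strE b]inE => /and3P[vE vW h]; split=> //; first by move: vW; rewrite inE.
  by apply/negP => /Rcore[c]; apply/negP/in_E.
have in_X1 v : v \in X1 -> [/\ v \notin verts tl, v \notin R & I true v && O true v].
  by rewrite inE => /orP[/(in_D true _ _ D1s)[/core_str]|/in_str[]].
have in_X2 v : v \in X2 -> [/\ v \notin verts tl, v \notin R & I false v && O false v].
  by rewrite inE => /orP[/(in_D false _ _ D2s)[/core_str]|]; [|rewrite inE => /andP[_ /in_str[]]].
have dX v : v \in X1 -> v \notin X2.
  rewrite [v \in X1]inE => /orP[v1|v1]; rewrite [v \in X2]inE negb_or; apply/andP; split.
  - apply/negP => v2; have [c1 _ _] := in_D true _ _ D1s v1; have [c2 _ _] := in_D false _ _ D2s v2.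
    by have := core_disj c1; rewrite c2.
  - apply/negP; rewrite inE => /andP[_ /in_str[vE _ _ _]].
    by have [c1 _ _] := in_D true _ _ D1s v1; have := in_E v vE true; rewrite c1.
  - apply/negP => v2; have [c2 _ _] := in_D false _ _ D2s v2.
    by have [vE _ _ _] := in_str _ _ v1; have := in_E v vE false; rewrite c2.
  by rewrite inE v1.
have [tl1 [t1 pm1 sb1 va1 pv1]] := insert_stays (vs := enum X1) tc (sides_tl true) vv
  ltac:(by move=> v; rewrite mem_enum => /in_X1[]).
have sides1 : sides false tl1 by rewrite (perm_sides _ pm1) /sides has_cat -/(sides false tl) sides_tl.
have [tl2 [t2 pm2 sb2 va2 pv2]] := insert_stays (vs := enum X2) t1 sides1 va1
  ltac:(by move=> v; rewrite mem_enum => /in_X2[]).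
have pv : perm_eq (verts tl2) (verts tl ++ enum X1 ++ enum X2).
  by rewrite catA (perm_trans pv2) // perm_cat2r.
have mem_v v : (v \in verts tl2) = [|| v \in verts tl, v \in X1 | v \in X2].
  by rewrite (perm_mem pv) !mem_cat !mem_enum.
have Uv2 : uniq (verts tl2).
  rewrite (perm_uniq pv) !cat_uniq Uv !enum_uniq andbT /= has_cat negb_or -andbA.
  apply/and3P; split; apply/hasPn => v; rewrite mem_enum => vX; apply/negP.
  - by have [/negPf h _ _] := in_X1 v vX; rewrite /= h.
  - by have [/negPf h _ _] := in_X2 v vX; rewrite /= h.
  by rewrite /= mem_enum => /dX; rewrite vX.
have npriv : {in verts tl2, forall v, v \notin R}.
  move=> v; rewrite mem_v => /or3P[/verts_in/orP[vs|]|/in_X1[]|/in_X2[]] //.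
    by apply: contraTN vs => /Rs.
  by rewrite inE => /andP[].
pose pl := [seq (t.1.1, bd t, t.2) | t <- tl2].
have Epl : flatten (verts pl) = flatten [seq bd t | t <- tl2].
  by rewrite /verts /pl -map_comp.
have sub_pl : subseq (verts tl2) (flatten (verts pl)).
  rewrite Epl; elim: (tl2) => //= t l IH; rewrite -[t.1.2 :: _]cat1s cat_subseq //.
  by rewrite /bd /bead sub1seq mem_cat mem_head orbT.
have ctl2 : size tl2 <= 22 * G.
  have := perm_size pv; rewrite !size_cat size_map -!cardE => ->.
  have c1 : #|X1| <= 2 * G + 1 + 2 * G.
    apply: leq_trans (leq_card_setU _ _).1 _; rewrite D1c leq_add2l; apply: leq_trans cE.
    by apply/subset_leq_card/subsetP => v /in_str[].
  have c2 : #|X2| <= 2 * G + 1 + 2 * G.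
    apply: leq_trans (leq_card_setU _ _).1 _; rewrite D2c leq_add2l; apply: leq_trans cE.
    by apply/subset_leq_card/subsetP => v; rewrite inE => /andP[_ /in_str[]].
  by move: c1 c2 stl kG k3; clear; lia.
have [||||| l [hl sl]] := complete_pieces (e := e) (core := core) (G := G) (tau := tau) core_disj core_nonout
  core_nonin (tchain_map bd t2) => //.
- apply/allP => p /mapP[t tin ->]; have vt : valid I O t by apply: (allP va2).
  have g := bead_good core_cin core_cout u1 h2 vt; exact: g.
- rewrite -/pl Epl; have g := beads_uniq e core tau tag u2 p22 Uv2 npriv; exact: g.
- have spl : size pl = size tl2 by rewrite size_map.
  rewrite -/pl Epl spl.
  have : size (flatten [seq bd t | t <- tl2]) <= 3 * size tl2.
    elim: (tl2) => //= t l IH; rewrite size_cat.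
    have : size (bd t) <= 3 := size_bead e core tau tag u1 t.
    by move: IH; clear; lia.
  move: ctl2 kG k3; rewrite /tau; move: (size tl2) (size (flatten _)); clear=> x y; lia.
- move=> v; rewrite -/pl => vn; have vn2 : v \notin verts tl2 by apply: contra vn; apply: mem_subseq.
  have [c1|c1] := boolP (v \in core true); first by exists true.
  have [c2|c2] := boolP (v \in core false); first by exists false.
  case/negP: vn2; rewrite mem_v; have [//|vt] := boolP (v \in verts tl).
  have vE : v \in E by rewrite inE c1 c2.
  have vs : v \notin s by apply: contra vt; apply: mem_subseq.
  have vR : v \notin R by apply/negP => /Rcore[c]; apply/negP/in_E.
  have vU : v \in U by rewrite inE vR.
  have [st|/(verts_str v vU)] := boolP (straight I O v); last by rewrite (negPf vt).
  have vW : v \notin W by rewrite inE.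
  have mstr b : (v \in strE b) = I b v && O b v by rewrite inE vE vW.
  have [m1|m1] := boolP (v \in strE true); first by rewrite [v \in X1]inE m1 !orbT.
  apply/orP; right; apply/orP; right; rewrite [v \in X2]inE; apply/orP; right.
  rewrite in_setD m1 mstr; move: st; rewrite /straight -(mstr true).
  by rewrite (negPf m1).
- move=> b; rewrite -/pl count_map (eq_count (a2 := fun t => t.1.1 == b)) //.
  have stay_count c (vs : seq T) : size vs <= count (fun t => t.1.1 == c) (stays c vs).
    by rewrite /stays count_map (eq_count (a2 := predT)) ?count_predT // => v /=; rewrite eqxx.
  rewrite (permP pm2) count_cat (permP pm1) count_cat.
  have g1 : 2 * G < #|X1|.
    by rewrite -addn1 -D1c; apply/subset_leq_card; apply: subsetUl.
  have g2 : 2 * G < #|X2|.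
    by rewrite -addn1 -D2c; apply/subset_leq_card; apply: subsetUl.
  case: b.
    apply: leq_trans g1 _; rewrite cardE; apply: leq_trans (stay_count true _) _.
    by rewrite -addnA addnCA leq_addr.
  apply: leq_trans g2 _; rewrite cardE; apply: leq_trans (stay_count false _) _.
  exact: leq_addl.
exists l; split=> //; exists 0; rewrite rot0.
apply: subseq_trans sl; apply: subseq_trans sub_pl; apply: subseq_trans sb2.
exact: subseq_trans sb1.
Qed.

End CliquePair.

(** * From a sparse pair of sets to two cores, and the final case distinction *)

Lemma sparse_ordered_hamiltonian (T : finType) (e : rel T) d k h (A B : {set T}) :
  irreflexive e -> 2 < k -> h = 2000 * k -> k * h <= #|T| -> #|T| + k <= d.*2.+2 ->
  (forall v, d <= dout e setT v) -> (forall v, d <= din e setT v) ->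
  d <= #|A| -> d <= #|B| -> #|A :&: B| * (5 * h * h) ^ 2 <= #|T| ->
  #|edges e A B| * (5 * h * h) ^ 2 <= #|T| ^ 2 -> k_ordered_hamiltonian e k.
Proof.
move=> irr k3 Eh; have h0 : 0 < h by rewrite Eh; move: k3; clear; lia.
move Eq : ((5 * h * h) ^ 2) => q.
move En : #|T| => n hn dk degO degI dA dB hAB heAB.
have dn : n <= d.*2 by move: dk k3; clear; lia.
have n0 : 0 < n by apply: leq_trans hn; rewrite muln_gt0 h0; move: k3; clear; lia.
have hBA : #|B :&: A| * q <= n by rewrite setIC.
have heBA : #|edges (fun x y => e y x) B A| * q <= n ^ 2.
  apply: leq_trans heAB; rewrite leq_mul2r; apply/orP; right.
  have swap_inj : injective (fun p : T * T => (p.2, p.1)) by move=> [x y] [x' y'] [-> ->].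
  rewrite -(card_imset _ swap_inj); apply/subset_leq_card/subsetP => p.
  by case/imsetP => -[x y]; rewrite !inE /= => /and3P[xB yA exy] ->; rewrite xB yA exy.
subst q; move: n0 dn hAB heAB hBA heBA; rewrite -En => n0 dn hAB heAB hBA heBA.
have [P [PA cP hP]] := near_clique h0 n0 dn degO dB hAB heAB.
(* Few arcs lead from A to B, so in the reversed digraph few lead from B to A, and B yields the
   second core. *)
have [Q [QB cQ hQ]] := near_clique (e := fun x y => e y x) h0 n0 dn degI dA hBA heBA.
pose core (b : bool) := if b then P else Q.
have toG m : h * m <= #|T| -> m <= #|T| %/ h by rewrite leq_divRL // mulnC.
have big (C D : {set T}) : d <= #|C| -> h * #|C :\: D| <= #|T| -> #|T| <= 2 * (#|D| + #|T| %/ h).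
  move=> dC /toG hC; have := cardsID D C; have : #|C :&: D| <= #|D| by rewrite subset_leq_card // subsetIr.
  by move: dC dn hC; move: #|C :\: D| #|C :&: D| (#|T| %/ h); clear; lia.
have sub (C D : {set T}) (Z : pred T) : D \subset C ->
    h * #|[set w in C | Z w]| <= #|T| -> #|[set w in D | Z w]| <= #|T| %/ h.
  move=> /subsetP DC /toG hC; apply: leq_trans hC; apply/subset_leq_card/subsetP => w.
  by rewrite !inE => /andP[/DC-> ->].
have PsubA : P \subset A by apply: subset_trans PA (subsetDl _ _).
have QsubB : Q \subset B by apply: subset_trans QB (subsetDl _ _).
(* G is the quotient n / h: k h <= n gives k <= G, and h = 2000 k gives 2000 k G <= n. *)
apply: (@clique_pair_ordered T e core (#|T| %/ h) d k #|T|) => //.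
- by rewrite En.
- case=> v /= hv; apply/negP => hv'.
    by have := subsetP PA v hv; rewrite inE (subsetP QsubB v hv').
  by have := subsetP QB v hv; rewrite inE (subsetP PsubA v hv').
- by case; [apply: big dA cP | apply: big dB cQ].
- by case=> v /= hv; [apply: sub PsubA _; case: (hP v hv) | apply: sub QsubB _; case: (hQ v hv)].
- by case=> v /= hv; [apply: sub PsubA _; case: (hP v hv) | apply: sub QsubB _; case: (hQ v hv)].
- by rewrite leq_divRL // En.
by rewrite -Eh mulnC leq_trunc_div.
Qed.

Theorem theorem1 :
  forall k : nat, 3 <= k ->
  exists n0 : nat,
    forall (T : finType) (e : rel T),
      digraph e -> n0 <= #|T| ->
      min_semideg_ge e (ceil_half (#|T| + k) - 1) ->
      k_ordered_hamiltonian e k.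
Proof.
move=> k k3; have [h Eh] : exists h, h = 2000 * k by exists (2000 * k).
have [n0 Hn0] := dense_ordered_hamiltonian ((5 * h * h) ^ 2) k3.
exists (maxn n0 (k * h)) => T e irr; rewrite geq_max => /andP[nT hT] deg.
pose d := ceil_half (#|T| + k) - 1.
have degO v : d <= dout e setT v.
  case: (deg v) => h1 _; apply: leq_trans h1 _; apply/subset_leq_card/subsetP => w.
  by rewrite !inE.
have degI v : d <= din e setT v.
  case: (deg v) => _ h1; apply: leq_trans h1 _; apply/subset_leq_card/subsetP => w.
  by rewrite !inE.
have dk : #|T| + k <= d.*2.+2.
  by rewrite /d /ceil_half; move: k3; move: #|T|; clear; lia.
pose dense (A B : {set T}) := (#|T| <= #|A :&: B| * (5 * h * h) ^ 2) ||
  (#|T| ^ 2 <= #|edges e A B| * (5 * h * h) ^ 2).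
have [/forallP allAB|] := boolP [forall A : {set T}, forall B : {set T},
    (d <= #|A|) ==> (d <= #|B|) ==> dense A B].
  apply: (Hn0 T e d) => // A B dA dB.
  by have /forallP/(_ B) := allAB A; rewrite dA dB => /orP.
rewrite negb_forall => /existsP[A]; rewrite negb_forall => /existsP[B].
rewrite !negb_imply negb_or -!ltnNge => /and4P[dA dB h1 h2].
exact: sparse_ordered_hamiltonian irr k3 Eh hT dk degO degI dA dB (ltnW h1) (ltnW h2).
Qed.
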